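(* Let $\mathcal{G}$ be a real gerbe on a smooth manifold $X$. Suppose $B$ is the holonomy form of a flat gerbe connection $\nabla$ on $\mathcal{G}$ with respect to a gerbe metric $h$ and an adaptation $\beta$ to $(\nabla,h)$. Then the class $[B]\in H^2(X,\mathbb{R})$ depends on $\nabla$ only. In fact $B$ represents the class $\tilde c(\nabla)$. Under the natural product decomposition $H^2(X,\mathbb{R}^* )=H^2(X,\mathbb{Z}_2)\times H^2(X,\mathbb{R})$, one has $c(\nabla)=([\mathcal{G}],[B])$.
   Context: A real gerbe $\mathcal{G}=\{U_i,l_{ij},s_{ijk}\}$ on $X$ consists of an open cover $\{U_i\}$ of $X$; real line bundles $l_{ij}$ on $U_i\cap U_j$ with given isomorphisms of $l_{ij}\otimes l_{ji}$ with the trivial bundle; and trivializations $s_{ijk}$ of $l_{ijk}=l_{ij}\otimes l_{jk}\otimes l_{ki}$ over $U_i\cap U_j\cap U_k$ that are co-closed ($\delta s=1$ on fourfold overlaps). After refining the cover so that each $l_{ij}$ has a trivialization $t_{ij}$ (with $t_{ji}=t_{ij}^{-1}$), write $s_{ijk}=r_{ijk}\,t_{ij}\otimes t_{jk}\otimes t_{ki}$; the cocycle $\{r_{ijk}\}$ defines the gerbe class $[\mathcal{G}]\in\check H^2(X,\underline{\mathbb{R}}^* )\cong H^2(X,\mathbb{Z}_2)$, where $\underline{\mathbb{R}}^*$ is the sheaf of smooth $\mathbb{R}^*$-valued functions and the isomorphism is induced by $\mathbb{Z}_2=\{\pm1\}\subset\underline{\mathbb{R}}^*$. A gerbe connection $\nabla=\{\nabla_{ij}\}$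 consists of connections $\nabla_{ij}$ on $l_{ij}$ (compatible with $l_{ij}\otimes l_{ji}\cong$ trivial) such that $s_{ijk}$ is covariant constant for $\nabla_{ij}\otimes\nabla_{jk}\otimes\nabla_{ki}$; it is flat if all $\nabla_{ij}$ are flat. A gerbe metric $h=\{h_{ij}\}$ consists of fiber metrics $h_{ij}$ on $l_{ij}$ (compatible with $l_{ij}\otimes l_{ji}\cong$ trivial) such that $s_{ijk}$ has norm $1$ for the induced product metric. Holonomy of a flat $\nabla$: choosing the $t_{ij}$ above to be $\nabla_{ij}$-flat, the $r_{ijk}$ are locally constant and define the holonomy $c(\nabla)\in\check H^2(X,\mathbb{R}^* )=H^2(X,\mathbb{R}^* )$ (constant coefficients). $\tilde c(\nabla)\in H^2(X,\mathbb{R})$ is the image of $c(\nabla)$ under $\ln|\cdot|:\mathbb{R}^*\to\mathbb{R}$. The product decomposition of $H^2(X,\mathbb{R}^* )$ is induced by $\mathbb{R}^*\cong\mathbb{Z}_2\times\mathbb{R}$, $x\mapsto(\mathrm{sgn}\,x,\ln|x|)$. For a connection $\nabla$ and a metric $h$ on a real line bundle $l$, $\theta(\nabla,h)=\nabla-\nabla_h$ is the holonomy form, where $\nabla_h$ is the unique (flat) $h$-compatible connection; in a local frame $s$ with $\nabla=d+a$ it is $a-\frac12 d\ln h(s,s)$. It is a closed 1-form if $\nabla$ is flat. An adaptation to $(\nabla,h)$, with $\nabla$ flat, is a collection $\beta=\{\beta_i\}$ of 1-forms $\beta_i$ on $U_i$ with $\beta_i-\beta_j=\theta(\nabla_{ij},h_{ij})$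 on $U_i\cap U_j$. The forms $d\beta_i$ fit together to a global 2-form $B$ on $X$, the holonomy form of $(\nabla,h,\beta)$. Čech–de Rham convention: if a closed 2-form satisfies $B=d\beta_i$ on $U_i$ and $\beta_i-\beta_j=df_{ij}$ on $U_i\cap U_j$, then $[B]\in H^2(X,\mathbb{R})$ corresponds to the Čech class of $\{f_{ij}+f_{jk}+f_{ki}\}$. *)

(* Defs.v *)
From HB Require Import structures.
From mathcomp Require Import all_boot all_order all_algebra.
From mathcomp Require Import all_classical all_reals all_analysis.

Set Implicit Arguments.
Unset Strict Implicit.
Unset Printing Implicit Defensive.

Import Order.TTheory GRing.Theory Num.Theory numFieldNormedType.Exports.
Local Open Scope ring_scope.
Local Open Scope classical_set_scope.

(** * Smooth manifolds *)

Section Euclidean.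
Variables (R : realType) (n : nat).

(* i-th partial derivative on R^n *)
Definition partial (i : 'I_n) (f : 'rV[R]_n -> R) (v : 'rV[R]_n) : R :=
  'D_(delta_mx 0 i) f v.

(* Only meant for open U.  Differentiability is redundant given that the
   partials are C^k for k >= 0, but is the library's notion. *)
Fixpoint Ck (k : nat) (U : set 'rV[R]_n) (f : 'rV[R]_n -> R) : Prop :=
  if k is k'.+1 then
    (forall v, U v -> differentiable f v) /\
    (forall i, Ck k' U (partial i f))
  else forall v, U v -> {for v, continuous f}.

Definition Cinfty (U : set 'rV[R]_n) (f : 'rV[R]_n -> R) : Prop :=
  forall k, Ck k U f.

End Euclidean.

(* The functions chart_map and chart_inv are total, but only their values on
   the chart domain, respectively on its image, are meaningful. *)
Record manifold (R : realType) (n : nat) := Manifold {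
  mcarrier :> topologicalType;
  manifold_hausdorff : hausdorff_space mcarrier;
  manifold_second_countable : @second_countable mcarrier;
  chart_idx : Type;
  chart_dom : chart_idx -> set mcarrier;
  chart_map : chart_idx -> mcarrier -> 'rV[R]_n;
  chart_inv : chart_idx -> 'rV[R]_n -> mcarrier;
  chart_dom_open : forall A, open (chart_dom A);
  chart_cover : \bigcup_A chart_dom A = setT;
  chart_image_open : forall A, open (chart_map A @` chart_dom A);
  chart_mapK : forall A x, chart_dom A x -> chart_inv A (chart_map A x) = x;
  chart_map_continuous : forall A x, chart_dom A x ->
    {for x, continuous (chart_map A)};
  chart_inv_continuous : forall A v, (chart_map A @` chart_dom A) v ->
    {for v, continuous (chart_inv A)};
  chart_transition : forall A A' k,
    Cinfty (chart_map A @` (chart_dom A `&` chart_dom A'))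
           (fun v => chart_map A' (chart_inv A v) 0 k)
}.

Section Forms.
Variables (R : realType) (n : nat) (X : manifold R n).
Implicit Types (U : set X) (f : X -> R) (A : chart_idx X).

Definition smooth_on U f : Prop := forall A,
  Cinfty (chart_map A @` (U `&` chart_dom A)) (fun v => f (chart_inv A v)).

(* d f / d x_i in the coordinates of the chart A *)
Definition chart_partial A (i : 'I_n) f (x : X) : R :=
  partial i (fun v => f (chart_inv A v)) (chart_map A x).

(* entry (i, j) is d y_j / d x_i, with x the coordinates of A, y those of A' *)
Definition jacobian A A' (x : X) : 'M[R]_n :=
  \matrix_(i, j) chart_partial A i (fun y => chart_map A' y 0 j) x.

(* Differential forms are given by their components in all charts:
   w = \sum_i (w A x 0 i) dx_i and
   B = \sum_(i < j) (B A x i j) dx_i /\ dx_j on chart_dom A. *)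
Definition form1 := chart_idx X -> X -> 'rV[R]_n.
Definition form2 := chart_idx X -> X -> 'M[R]_n.

Definition is_form1 U (w : form1) : Prop :=
  (forall A i, smooth_on (U `&` chart_dom A) (fun x => w A x 0 i)) /\
  (forall A A' x, U x -> chart_dom A x -> chart_dom A' x ->
     w A x = w A' x *m (jacobian A A' x)^T).

Definition is_form2 U (B : form2) : Prop :=
  [/\ forall A i j, smooth_on (U `&` chart_dom A) (fun x => B A x i j),
      forall A x, U x -> chart_dom A x -> (B A x)^T = - B A x
    & forall A A' x, U x -> chart_dom A x -> chart_dom A' x ->
        B A x = jacobian A A' x *m B A' x *m (jacobian A A' x)^T].

Definition eq_form1 U (w w' : form1) : Prop :=
  forall A x, U x -> chart_dom A x -> w A x = w' A x.

Definition eq_form2 U (B B' : form2) : Prop :=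
  forall A x, U x -> chart_dom A x -> B A x = B' A x.

Definition sub_form1 (w w' : form1) : form1 := fun A x => w A x - w' A x.
Definition sub_form2 (B B' : form2) : form2 := fun A x => B A x - B' A x.
Definition add_form1 (w w' : form1) : form1 := fun A x => w A x + w' A x.
Definition scale_form1 f (w : form1) : form1 := fun A x => f x *: w A x.

Definition d0 f : form1 := fun A x => \row_i chart_partial A i f x.

Definition d1 (w : form1) : form2 := fun A x => \matrix_(i, j)
  (chart_partial A i (fun y => w A y 0 j) x -
   chart_partial A j (fun y => w A y 0 i) x).

(* equality of classes in the second de Rham cohomology of X *)
Definition de_rham_cohomologous (B B' : form2) : Prop :=
  exists2 w : form1, is_form1 setT w & eq_form2 setT (sub_form2 B B') (d1 w).

End Forms.

(** * Cech cohomology in degree 2 *)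

Record open_cover (T : topologicalType) := OpenCover {
  cov_idx : Type;
  cov_set :> cov_idx -> set T;
  cov_open : forall i, open (cov_set i);
  cov_cover : \bigcup_i cov_set i = setT
}.

Section Cech.
Variables (R : realType) (n : nat) (X : manifold R n).

Definition refines (V U : open_cover X) (rho : cov_idx V -> cov_idx U) : Prop :=
  forall a, V a `<=` U (rho a).

(* A sheaf of abelian groups whose sections over U are the functions
   satisfying coef_sec U (two such functions are the same section if they agree
   on U), with the pointwise group law coef_op.  *)
Record coefficients := Coefficients {
  coef_op : R -> R -> R;
  coef_sec : set X -> (X -> R) -> Prop
}.

Definition locally_constant (U : set X) (f : X -> R) : Prop :=
  forall x, U x -> \forall y \near x, f y = f x.

(* constant coefficients R, R^* and Z_2 = {1, -1} *)
Definition coef_R : coefficients :=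
  Coefficients (fun a b => a + b) locally_constant.

Definition coef_Rstar : coefficients :=
  Coefficients (fun a b => a * b)
    (fun U f => locally_constant U f /\ forall x, U x -> f x != 0).

Definition coef_Z2 : coefficients :=
  Coefficients (fun a b => a * b)
    (fun U f => locally_constant U f /\ forall x, U x -> f x = 1 \/ f x = -1).

(* the sheaf of smooth R^*-valued functions *)
Definition coef_smooth_Rstar : coefficients :=
  Coefficients (fun a b => a * b)
    (fun U f => smooth_on U f /\ forall x, U x -> f x != 0).

Record cochain2 := Cochain2 {
  c2_cover : open_cover X;
  c2_val :> cov_idx c2_cover -> cov_idx c2_cover -> cov_idx c2_cover -> X -> R
}.

(* All triples of indices are allowed and cochains need not be alternating.
   The second condition is delta c = 1, with inverses cleared. *)
Definition is_cocycle (F : coefficients) (c : cochain2) : Prop :=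
  let V := c2_cover c in
  (forall i j k, coef_sec F (V i `&` V j `&` V k) (c i j k)) /\
  (forall i j k l x, (V i `&` V j `&` V k `&` V l) x ->
     coef_op F (c j k l x) (c i j l x) = coef_op F (c i k l x) (c i j k x)).

(* c' = c * delta q on a common refinement W, with
   (delta q)_abd = q_bd * q_ad^-1 * q_ab. *)
Definition cohomologous (F : coefficients) (c c' : cochain2) : Prop :=
  exists (W : open_cover X) (rho : cov_idx W -> cov_idx (c2_cover c))
         (rho' : cov_idx W -> cov_idx (c2_cover c'))
         (q : cov_idx W -> cov_idx W -> X -> R),
    [/\ refines rho, refines rho',
        forall a b, coef_sec F (W a `&` W b) (q a b)
      & forall a b d x, (W a `&` W b `&` W d) x ->
          coef_op F (c' (rho' a) (rho' b) (rho' d) x) (q a d x) =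
          coef_op F (coef_op F (c (rho a) (rho b) (rho d) x) (q a b x))
                    (q b d x)].

(* The class of c in the direct limit over covers of the Cech groups with
   coefficients F: the set of all cocycles that represent it. *)
Definition cech_class (F : coefficients) (c : cochain2) : set cochain2 :=
  [set c' | is_cocycle F c' /\ cohomologous F c c'].

Definition map_cochain (phi : R -> R) (c : cochain2) : cochain2 :=
  Cochain2 (fun i j k x => phi (c i j k x)).

(* Components of the class of the R^*-cocycle c under the decomposition
   H^2(X, R^* ) = H^2(X, Z_2) x H^2(X, R) induced by t |-> (sgn t, ln |t|). *)
Definition sgn_class (c : cochain2) : set cochain2 :=
  cech_class coef_Z2 (map_cochain Num.sg c).

Definition lnabs_class (c : cochain2) : set cochain2 :=
  cech_class coef_R (map_cochain (fun t : R => ln `|t|) c).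

(* The 2-form B corresponds to the Cech cocycle {f_ij + f_jk + f_ki}. *)
Definition cech_de_rham (B : form2 X) (y : cochain2) : Prop :=
  let V := c2_cover y in
  exists (beta : cov_idx V -> form1 X) (f : cov_idx V -> cov_idx V -> X -> R),
    [/\ forall i, is_form1 (V i) (beta i) /\ eq_form2 (V i) B (d1 (beta i)),
        forall i j, smooth_on (V i `&` V j) (f i j),
        forall i j x, (V i `&` V j) x -> f j i x = - f i j x,
        forall i j, eq_form1 (V i `&` V j)
                      (sub_form1 (beta i) (beta j)) (d0 (f i j))
      & forall i j k x, (V i `&` V j `&` V k) x ->
          y i j k x = f i j x + f j k x + f k i x].

(* [B] as a class in Cech cohomology with constant real coefficients *)
Definition de_rham_class (B : form2 X) : set cochain2 :=
  [set y | is_cocycle coef_R y /\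
     exists y', [/\ is_cocycle coef_R y', cech_de_rham B y'
                  & cohomologous coef_R y' y]].

End Cech.

(** * Real line bundles *)

Section LineBundles.
Variables (R : realType) (n : nat) (X : manifold R n).

(* A real line bundle over the open set U: the fibers over U are real lines,
   and the smooth structure is given by local frames related by smooth
   transition functions.  Fibers over points outside U are irrelevant. *)
Record line_bundle (U : set X) := LineBundle {
  fiber :> X -> lmodType R;
  lb_idx : Type;
  lb_dom : lb_idx -> set X;
  lb_frame : lb_idx -> forall x, fiber x;
  lb_dom_open : forall m, open (lb_dom m);
  lb_dom_cover : \bigcup_m lb_dom m = U;
  lb_frame_basis : forall m x, lb_dom m x ->
    lb_frame m x != 0 /\ forall v : fiber x, exists t, v = t *: lb_frame m x;
  lb_transition : forall m m', exists2 g : X -> R,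
    smooth_on (lb_dom m `&` lb_dom m') g &
    forall x, (lb_dom m `&` lb_dom m') x ->
      lb_frame m x = g x *: lb_frame m' x
}.

Section Structures.
Variables (U : set X) (l : line_bundle U).

(* s restricts to a smooth trivialization of l on W *)
Definition local_frame (W : set X) (s : forall x, l x) : Prop :=
  (forall x, W x -> s x != 0) /\
  (forall m : lb_idx l, exists2 f : X -> R, smooth_on (W `&` lb_dom m) f &
     forall x, (W `&` lb_dom m) x -> s x = f x *: lb_frame m x).

(* A connection is given by its connection forms in the local frames e_m of l,
   nabla e_m = (conn_form m) e_m; equivalently nabla = d + conn_form m. *)
Record connection := Connection {
  conn_form :> lb_idx l -> form1 X;
  conn_smooth : forall m, is_form1 (lb_dom m) (conn_form m);
  conn_gauge : forall (m m' : lb_idx l) (g : X -> R),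
    smooth_on (lb_dom m `&` lb_dom m') g ->
    (forall x, (lb_dom m `&` lb_dom m') x ->
       lb_frame m x = g x *: lb_frame m' x) ->
    eq_form1 (lb_dom m `&` lb_dom m') (conn_form m)
      (add_form1 (conn_form m') (scale_form1 (fun x => (g x)^-1) (d0 g)))
}.

(* vanishing curvature *)
Definition flat (D : connection) : Prop :=
  forall m, eq_form2 (lb_dom m) (d1 (D m)) (fun _ _ => 0).

(* nabla s = 0 on W: if s = f e_m then nabla s = (df + f (D m)) e_m *)
Definition flat_section (D : connection) (W : set X) (s : forall x, l x) :=
  forall (m : lb_idx l) (f : X -> R), smooth_on (W `&` lb_dom m) f ->
    (forall x, (W `&` lb_dom m) x -> s x = f x *: lb_frame m x) ->
    eq_form1 (W `&` lb_dom m)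
      (add_form1 (d0 f) (scale_form1 f (D m))) (fun _ _ => 0).

Record metric := Metric {
  met :> forall x, l x -> l x -> R;
  met_linear : forall x, U x -> forall v, scalar (fun u => @met x u v : R);
  met_sym : forall x, U x -> forall u v : l x, @met x u v = @met x v u;
  met_pos : forall x, U x -> forall u : l x, u != 0 -> 0 < @met x u u;
  met_smooth : forall m : lb_idx l,
    smooth_on (lb_dom m) (fun x => @met x (lb_frame m x) (lb_frame m x))
}.

(* d h(s, s) = 2 h(nabla s, s) *)
Definition metric_compatible (D : connection) (h : metric) : Prop :=
  forall m : lb_idx l,
    let hm := fun x => h x (lb_frame m x) (lb_frame m x) in
    eq_form1 (lb_dom m) (d0 hm) (scale_form1 (fun x => 2 * hm x) (D m)).

(* w is the holonomy form theta(D, h) = D - D_h; the difference of two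
   connections is the difference of their connection forms in any frame. *)
Definition is_theta (D : connection) (h : metric) (w : form1 X) : Prop :=
  exists2 Dh : connection, metric_compatible Dh h &
    forall m, eq_form1 (lb_dom m) w (sub_form1 (D m) (Dh m)).

End Structures.
End LineBundles.

(** * Real gerbes *)

Section Gerbes.
Variables (R : realType) (n : nat) (X : manifold R n).

(* An isomorphism of a tensor product of line bundles with the trivial bundle is
   given as the corresponding nowhere vanishing multilinear form:
   - gb_pair i j : l_ij (x) l_ji -> R is the given isomorphism; the one for
     (j, i) is the same up to exchanging the factors;
   - gb_triv i j k : l_ij (x) l_jk (x) l_ki -> R is the isomorphism that sends
     the trivializing section s_ijk to 1.
   Indices may coincide. *)
Record gerbe := Gerbe {
  gb_cover : open_cover X;
  gb_line : forall i j, line_bundle (gb_cover i `&` gb_cover j);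
  gb_pair : forall i j x, gb_line i j x -> gb_line j i x -> R;
  gb_pair_linear : forall i j x, (gb_cover i `&` gb_cover j) x ->
    forall b, scalar (fun a => @gb_pair i j x a b : R);
  gb_pair_sym : forall i j x, (gb_cover i `&` gb_cover j) x ->
    forall a b, @gb_pair j i x b a = gb_pair a b;
  gb_pair_neq0 : forall i j x, (gb_cover i `&` gb_cover j) x ->
    forall a b, a != 0 -> b != 0 -> @gb_pair i j x a b != 0;
  gb_pair_smooth : forall i j (m : lb_idx (gb_line i j))
      (m' : lb_idx (gb_line j i)),
    smooth_on (lb_dom m `&` lb_dom m')
      (fun x => @gb_pair i j x (lb_frame m x) (lb_frame m' x));
  gb_triv : forall i j k x,
    gb_line i j x -> gb_line j k x -> gb_line k i x -> R;
  gb_triv_linear : forall i j k x,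
    (gb_cover i `&` gb_cover j `&` gb_cover k) x ->
    [/\ forall b c, scalar (fun a => @gb_triv i j k x a b c : R),
        forall a c, scalar (fun b => @gb_triv i j k x a b c : R)
      & forall a b, scalar (fun c => @gb_triv i j k x a b c : R)];
  gb_triv_neq0 : forall i j k x,
    (gb_cover i `&` gb_cover j `&` gb_cover k) x ->
    forall a b c, a != 0 -> b != 0 -> c != 0 -> @gb_triv i j k x a b c != 0;
  gb_triv_smooth : forall i j k (m : lb_idx (gb_line i j))
      (m' : lb_idx (gb_line j k)) (m'' : lb_idx (gb_line k i)),
    smooth_on (lb_dom m `&` lb_dom m' `&` lb_dom m'')
      (fun x =>
         @gb_triv i j k x (lb_frame m x) (lb_frame m' x) (lb_frame m'' x));
  (* delta s = s_jkl s_ikl^-1 s_ijl s_ijk^-1 = 1, where the remaining factors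
     l_lj (x) l_jl and (l_ik (x) l_ki)^-1 are trivialized by gb_pair *)
  gb_coclosed : forall i j k l x,
    (gb_cover i `&` gb_cover j `&` gb_cover k `&` gb_cover l) x ->
    forall (ij : gb_line i j x) (jk : gb_line j k x) (kl : gb_line k l x)
           (li : gb_line l i x) (ik : gb_line i k x) (ki : gb_line k i x)
           (jl : gb_line j l x) (lj : gb_line l j x),
      gb_triv jk kl lj * gb_triv ij jl li * gb_pair ik ki =
      gb_triv ik kl li * gb_triv ij jk ki * gb_pair jl lj
}.

Arguments gb_line : clear implicits.

Variable G : gerbe.
Let U := gb_cover G.

(* In local frames e of the line bundles, the conditions say that the forms
   gb_pair and gb_triv (equivalently, the sections s_ijk) are covariant constant
   for the induced connections: d (s(e, e', e'')) = (a + a' + a'') s(e, e', e'')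
   where a, a', a'' are the connection forms in the frames e, e', e''. *)
Record gerbe_connection := GerbeConnection {
  gc_conn :> forall i j, connection (gb_line G i j);
  gc_pair : forall i j (m : lb_idx (gb_line G i j))
      (m' : lb_idx (gb_line G j i)),
    let p := fun x => gb_pair (lb_frame m x) (lb_frame m' x) in
    eq_form1 (lb_dom m `&` lb_dom m') (d0 p)
      (scale_form1 p (add_form1 (gc_conn i j m) (gc_conn j i m')));
  gc_triv : forall i j k (m : lb_idx (gb_line G i j))
      (m' : lb_idx (gb_line G j k)) (m'' : lb_idx (gb_line G k i)),
    let s := fun x => gb_triv (lb_frame m x) (lb_frame m' x) (lb_frame m'' x) in
    eq_form1 (lb_dom m `&` lb_dom m' `&` lb_dom m'') (d0 s)
      (scale_form1 s (add_form1 (add_form1 (gc_conn i j m) (gc_conn j k m'))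
                                (gc_conn k i m'')))
}.

Definition gerbe_flat (D : gerbe_connection) : Prop :=
  forall i j, flat (D i j).

(* The isomorphisms gb_pair and gb_triv are isometries for the product metric;
   for gb_triv this says that s_ijk has norm 1. *)
Record gerbe_metric := GerbeMetric {
  gm_met :> forall i j, metric (gb_line G i j);
  gm_pair : forall i j x, (U i `&` U j) x ->
    forall (a : gb_line G i j x) (b : gb_line G j i x),
      (gb_pair a b) ^+ 2 = gm_met i j x a a * gm_met j i x b b;
  gm_triv : forall i j k x, (U i `&` U j `&` U k) x ->
    forall (a : gb_line G i j x) (b : gb_line G j k x) (c : gb_line G k i x),
      (gb_triv a b c) ^+ 2 =
      gm_met i j x a a * gm_met j k x b b * gm_met k i x c c
}.

(* t consists of trivializations t_ab, with t_ba = t_ab^-1, of the line bundles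
   of the gerbe pulled back to the refinement V of its cover. *)
Definition gerbe_trivialization (V : open_cover X)
    (rho : cov_idx V -> cov_idx U)
    (t : forall a b x, gb_line G (rho a) (rho b) x) : Prop :=
  [/\ refines rho,
      forall a b, local_frame (V a `&` V b) (t a b)
    & forall a b x, (V a `&` V b) x -> gb_pair (t a b x) (t b a x) = 1].

(* s_ijk = r_ijk t_ij (x) t_jk (x) t_ki, where gb_triv maps s_ijk to 1 *)
Definition trivialization_cocycle (r : cochain2 X)
    (rho : cov_idx (c2_cover r) -> cov_idx U)
    (t : forall a b x, gb_line G (rho a) (rho b) x) : Prop :=
  let V := c2_cover r in
  forall a b d x, (V a `&` V b `&` V d) x ->
    1 = r a b d x * gb_triv (t a b x) (t b d x) (t d a x).

(* cocycles that define [G] in the cohomology of smooth R^*-valued functions *)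
Definition gerbe_cocycle (r : cochain2 X) : Prop :=
  is_cocycle (coef_smooth_Rstar X) r /\
  exists rho t, @gerbe_trivialization (c2_cover r) rho t /\
                trivialization_cocycle t.

(* [G] as a class in H^2(X, Z_2): the Z_2-cocycles whose image under the
   inclusion of Z_2 in the smooth R^*-valued functions represents [G] *)
Definition gerbe_class : set (cochain2 X) :=
  [set z | is_cocycle (coef_Z2 X) z /\
     exists2 r, gerbe_cocycle r & cohomologous (coef_smooth_Rstar X) z r].

(* cocycles that define the holonomy c(D) in H^2(X, R^* ) *)
Definition holonomy_cocycle (D : gerbe_connection) (r : cochain2 X) : Prop :=
  is_cocycle (coef_Rstar X) r /\
  exists rho t,
    [/\ @gerbe_trivialization (c2_cover r) rho t,
        forall a b, flat_section (D (rho a) (rho b))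
          (c2_cover r a `&` c2_cover r b) (t a b)
      & trivialization_cocycle t].

Definition adaptation (D : gerbe_connection) (h : gerbe_metric)
    (beta : cov_idx U -> form1 X) : Prop :=
  (forall i, is_form1 (U i) (beta i)) /\
  (forall i j, is_theta (D i j) (h i j) (sub_form1 (beta i) (beta j))).

(* B is the holonomy form of (D, h, beta) *)
Definition holonomy_form (D : gerbe_connection) (h : gerbe_metric)
    (beta : cov_idx U -> form1 X) (B : form2 X) : Prop :=
  [/\ adaptation D h beta, is_form2 setT B
    & forall i, eq_form2 (U i) B (d1 (beta i))].

End Gerbes.

(* Main.v *)
From HB Require Import structures.
Require Import Defs.
From mathcomp Require Import all_boot all_order all_algebra.
From mathcomp Require Import all_classical all_reals all_analysis.
From mathcomp Require Import ring lra.

(** The idea is to compute in frames that are adapted to the connection. If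
    t_ij is a flat frame of l_ij, then the connection form of nabla_ij in this
    frame is zero, so the holonomy form theta(nabla_ij, h_ij) is the
    differential of f_ij = - (1/2) ln h_ij(t_ij, t_ij) ([flat_frame_theta]).
    Therefore beta_i - beta_j = df_ij, and [B] corresponds to the Cech class
    of f_ij + f_jk + f_ki. Since s_ijk = r_ijk t_ij (x) t_jk (x) t_ki has norm
    1, this sum equals ln |r_ijk| ([trivialization_log_sum]): the cocycle ln
    |r_ijk| itself comes with de Rham data for B ([holonomy_de_rham]), without
    any change by a coboundary.

    The Cech class of a closed 2-form is defined through arbitrary de Rham
    data. Two sets of data for the same form differ by closed 1-forms, which
    have local primitives by Poincare's lemma ([poincare]); the primitives
    turn the difference of the two Cech cocycles into the coboundary of
    locally constant functions ([closed_forms_coboundary],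
    [cech_de_rham_cohomologous]).

    That B up to exact forms depends on nabla only is proved directly. For two
    metrics h and h' the logarithms of the ratios h'_ij / h_ij form an
    additive cocycle of smooth functions, and theta(nabla_ij, h_ij) -
    theta(nabla_ij, h'_ij) is half the differential of this logarithm
    ([theta_diff]). A partition of unity makes the cocycle a coboundary
    ([smooth_coboundary]), and corrected by the differentials of the resulting
    functions, the differences of the two adaptations glue to a global
    primitive of the difference of the holonomy forms
    ([holonomy_form_independent]).

    For the sign, |r_ijk| is the coboundary of the positive functions exp
    f_ij, so sgn r_ijk represents the gerbe class as a cocycle of smooth
    functions. That no other class in H^2(X, Z_2) does so follows from the
    fact that any two trivializations of the gerbe define cohomologous
    cocycles ([trivialization_comparison]): the sign of a smooth nowhere
    vanishing cochain is locally constant ([sgn_class_gerbe_class]). *)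

Set Implicit Arguments.
Unset Strict Implicit.
Unset Printing Implicit Defensive.

Import Order.TTheory GRing.Theory Num.Theory numFieldNormedType.Exports.
Local Open Scope ring_scope.
Local Open Scope classical_set_scope.

(** * Differentials and partial derivatives *)

Section Differentiability.
Context {R : realType}.
Implicit Types V W : normedModType R.

(** The definition of the differential without Landau symbols, for use with
    explicit estimates of the remainder. *)
Lemma differentiable_expansion V W (f : V -> W) (L : {linear V -> W}) (x : V) :
  continuous L ->
  (forall e : R, 0 < e -> \forall h \near (0 : V),
     `|f (h + x) - f x - L h| <= e * `|h|) ->
  differentiable f x /\ 'd f x = L :> (V -> W).
Proof.
move=> cL fL.
have E : f \o shift x = cst (f x) + L +o_ 0 id.
  apply/eqaddoP => e e0.
  apply: filterS (fL e e0) => h; rewrite /= !fctE /=.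
  by rewrite opprD addrA.
have dE := diff_unique cL E.
by split=> //; apply/diff_locallyP; rewrite dE.
Qed.

Lemma near_eq_differentiable V W (f g : V -> W) (x : V) :
  (\near x, f x = g x) -> differentiable f x -> differentiable g x.
Proof.
move=> fg df; pose L : {linear V -> W} := 'd f x.
apply: (proj1 (@differentiable_expansion _ _ g L x _ _)).
  exact: diff_continuous.
move=> e e0.
have /diff_locally/eqaddoP/(_ e e0) := df.
have fgh : \forall h \near (0 : V), f (h + x) = g (h + x).
  move: fg; rewrite (near_shift 0) /=.
  by apply: filterS => h /=; rewrite subr0.
apply: filter_app; apply: filterS fgh => h fgh.
by rewrite /= !fctE /= fgh (nbhs_singleton fg) opprD addrA.
Qed.

End Differentiability.


Section Partial.
Context {R : realType}.

Lemma differentiable_rV m n (T : 'rV[R]_m -> 'rV[R]_n) (v : 'rV[R]_m) :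
  (forall j, differentiable (fun u => T u 0 j) v) -> differentiable T v.
Proof.
move=> dT.
rewrite (_ : T = \sum_(j < n) (fun u => T u 0 j *: (delta_mx 0 j : 'rV[R]_n))).
  by apply: differentiable_sum => j; exact: differentiableZl.
by apply/funext => u; rewrite fct_sumE; exact: row_sum_delta.
Qed.

Lemma derive_partials n (f : 'rV[R]_n -> R) (v u : 'rV[R]_n) :
  differentiable f v -> 'D_u f v = \sum_j u 0 j * partial j f v.
Proof.
move=> df; rewrite deriveE// {1}(row_sum_delta u) linear_sum /=.
by apply: eq_bigr => j _; rewrite linearZ /partial deriveE.
Qed.

Lemma partial_comp m n (T : 'rV[R]_m -> 'rV[R]_n) (f : 'rV[R]_n -> R)
    (v : 'rV[R]_m) :
  (forall j, differentiable (fun u => T u 0 j) v) -> differentiable f (T v) ->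
  differentiable (fun u => f (T u)) v /\
  forall i, partial i (fun u => f (T u)) v =
    \sum_j partial j f (T v) * partial i (fun u => T u 0 j) v.
Proof.
move=> dTj df; have dT := differentiable_rV dTj.
have dfT : differentiable (f \o T) v by exact: differentiable_comp.
split=> // i; rewrite /partial deriveE// diff_comp//= -deriveE//.
rewrite derive_partials//; apply: eq_bigr => j _; rewrite mulrC; congr (_ * _).
rewrite -deriveE// derive_mx ?mxE//; exact: diff_derivable.
Qed.

Variable n : nat.
Implicit Types (v : 'rV[R]_n) (f g : 'rV[R]_n -> R) (i : 'I_n).

Lemma partial_near_eq i f g v :
  (\near v, f v = g v) -> partial i f v = partial i g v.
Proof. exact: near_eq_derive. Qed.

Lemma partialD i f g v : differentiable f v -> differentiable g v ->
  partial i (fun u => f u + g u) v = partial i f v + partial i g v.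
Proof. by move=> df dg; rewrite /partial deriveD//; exact: diff_derivable. Qed.

Lemma partialN i f v : differentiable f v ->
  partial i (fun u => - f u) v = - partial i f v.
Proof. by move=> df; rewrite /partial deriveN//; exact: diff_derivable. Qed.

Lemma partialB i f g v : differentiable f v -> differentiable g v ->
  partial i (fun u => f u - g u) v = partial i f v - partial i g v.
Proof. by move=> df dg; rewrite /partial deriveB//; exact: diff_derivable. Qed.

Lemma partialM i f g v : differentiable f v -> differentiable g v ->
  partial i (fun u => f u * g u) v = f v * partial i g v + g v * partial i f v.
Proof. by move=> df dg; rewrite /partial deriveM//; exact: diff_derivable. Qed.

Lemma partial_cst i (c : R) v : partial i (fun _ => c) v = 0.
Proof. exact: derive_cst. Qed.

Lemma partial_coord i j v : partial i (fun u => u 0 j) v = (i == j)%:R.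
Proof.
rewrite /partial; have /derive_mx : derivable id v (delta_mx 0 i : 'rV[R]_n) by
  [].
by rewrite derive_id => /matrixP/(_ 0 j); rewrite !mxE eqxx /= eq_sym => ->.
Qed.

Lemma partial_comp1 (b : R -> R) (db : R) f v :
  is_derive (f v) 1 b db -> differentiable f v ->
  differentiable (fun u => b (f u)) v /\
  forall i, partial i (fun u => b (f u)) v = db * partial i f v.
Proof.
move=> [dbx bE] df; have db' : differentiable b (f v) by exact/derivable1_diffP.
have dbf : differentiable (b \o f) v by exact: differentiable_comp.
split=> // i; rewrite /partial deriveE// diff_comp//= (diff1E db').
by rewrite -deriveE// derive1E bE mulrC.
Qed.
End Partial.

(** * Calculus of C^k functions *)

Section CkCalculus.
Context {R : realType} {n : nat}.
Implicit Types (U V : set 'rV[R]_n) (f g : 'rV[R]_n -> R) (k : nat).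

Lemma Ck_sub k U V f : U `<=` V -> Ck k V f -> Ck k U f.
Proof.
move=> UV; elim: k f => [|k IH] f /=; first by move=> + v /UV; exact.
by move=> [df pf]; split=> [v /UV /df|i]; [|exact/IH].
Qed.

(** [Ck k U f] unfolds to conditions at the single points of [U], whence the
    locality, for sets [V] that need not be open. *)
Lemma Ck_pointwise k U f :
  (forall v, U v -> exists2 V, V v & Ck k V f) -> Ck k U f.
Proof.
elim: k f => [|k IH] f UV; first by move=> v /UV[V Vv]; exact.
split=> [v /UV[V Vv fV]|i]; first exact: (proj1 fV v Vv).
by apply: IH => v /UV[V Vv fV]; exists V => //; exact: (proj2 fV i).
Qed.

Lemma Ck_eq k U f g : open U -> (forall v, U v -> f v = g v) ->
  Ck k U f -> Ck k U g.
Proof.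
move=> oU; have nearU v : U v -> \forall u \near v, U u.
  by move=> Uv; apply: open_nbhs_nbhs; split.
elim: k f g => [|k IH] f g fg /=.
  move=> cf v Uv; have nfg : \forall u \near v, f u = g u.
    by apply: filterS (nearU v Uv) => u /fg.
  rewrite /prop_for /continuous_at -(fg v Uv).
  apply: cvg_trans (cf v Uv : f @ v --> f v); exact: near_eq_cvg nfg.
move=> [df pf]; split=> [v Uv|i].
  apply: near_eq_differentiable (df v Uv).
  by apply: filterS (nearU v Uv) => u /fg.
apply: IH (pf i) => v Uv; apply: partial_near_eq.
by apply: filterS (nearU v Uv) => u /fg.
Qed.

Lemma CkS k U f : Ck k.+1 U f -> Ck k U f.
Proof.
elim: k f => [|k IH] f.
  by move=> [df _] v Uv; exact/differentiable_continuous/df.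
by move=> [df pf]; split=> // i; exact/IH/pf.
Qed.

Lemma Ck_cst k U (c : R) : open U -> Ck k U (fun _ => c).
Proof.
move=> oU; elim: k c => [|k IH] c; first by move=> v _;
  exact: (@cst_continuous _ _ c).
split=> [v _|i]; first exact: differentiable_cst.
by apply: Ck_eq (IH 0) => // v _; rewrite partial_cst.
Qed.

Lemma CkD k U f g : open U -> Ck k U f -> Ck k U g ->
  Ck k U (fun v => f v + g v).
Proof.
move=> oU; elim: k f g => [|k IH] f g.
  by move=> cf cg v Uv; apply: (cvgD (cf v Uv) (cg v Uv)).
move=> [df pf] [dg pg]; split=> [v Uv|i].
  by apply: differentiableD; [exact: df|exact: dg].
apply: Ck_eq (IH _ _ (pf i) (pg i)) => // v Uv.
by rewrite partialD//; [exact: df|exact: dg].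
Qed.

Lemma CkM k U f g : open U -> Ck k U f -> Ck k U g ->
  Ck k U (fun v => f v * g v).
Proof.
move=> oU; elim: k f g => [|k IH] f g.
  by move=> cf cg v Uv; apply: (cvgM (cf v Uv) (cg v Uv)).
move=> fk gk; have [df pf] := fk; have [dg pg] := gk; split=> [v Uv|i].
  by apply: differentiableM; [exact: df|exact: dg].
apply: (@Ck_eq _ _ (fun v => f v * partial i g v + g v * partial i f v)) => //.
  by move=> v Uv; rewrite partialM//; [exact: df|exact: dg].
apply: CkD => //; apply: IH => //; by [exact: CkS|exact: pf|exact: pg].
Qed.

Lemma CkN k U f : open U -> Ck k U f -> Ck k U (fun v => - f v).
Proof.
move=> oU fk; apply: (@Ck_eq _ _ (fun v => -1 * f v)) => //.
  by move=> v _; rewrite mulN1r.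
by apply: CkM => //; exact: Ck_cst.
Qed.

Lemma CkB k U f g : open U -> Ck k U f -> Ck k U g ->
  Ck k U (fun v => f v - g v).
Proof. by move=> oU fk gk; apply: CkD => //; exact: CkN. Qed.

Lemma Ck_sum k U m (F : 'I_m -> 'rV[R]_n -> R) : open U ->
  (forall j, Ck k U (F j)) -> Ck k U (fun v => \sum_j F j v).
Proof.
move=> oU; elim: m F => [|m IH] F Fk.
  by apply: Ck_eq (Ck_cst k 0 oU) => // v _; rewrite big_ord0.
apply: (@Ck_eq _ _ (fun v => \sum_(j < m) F (widen_ord (leqnSn m) j) v
                              + F ord_max v)) => //.
  by move=> v _; rewrite big_ord_recr.
by apply: CkD => //; apply: IH.
Qed.

Lemma Ck_coord k U j : open U -> Ck k U (fun v => v 0 j).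
Proof.
move=> oU; have dj v : differentiable (fun u : 'rV[R]_n => u 0 j : R) v.
  exact: differentiable_coord.
case: k => [|k]; first by move=> v _; exact/differentiable_continuous/dj.
split=> [v _|i]; first exact: dj.
by apply: Ck_eq (Ck_cst k (i == j)%:R oU) => // v _; rewrite partial_coord.
Qed.

(** Composition with a function of one variable, by induction on the order of
    differentiability. The functions that need the lemma come in families [b]
    whose derivatives [db] are expressions in the members of the same family,
    so the induction is made for the whole family at once. *)
Lemma Ck_comp1 (T : Type) (b db : T -> R -> R) k U f :
  open U ->
  (forall t v, U v -> is_derive (f v) 1 (b t) (db t (f v))) ->
  (forall t k', (forall t', Ck k' U (fun v => b t' (f v))) -> Ck k' U f ->
     Ck k' U (fun v => db t (f v))) ->
  Ck k U f -> forall t, Ck k U (fun v => b t (f v)).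
Proof.
move=> oU bD dbC; elim: k => [|k IH] fk t.
  move=> v Uv; have [dbt _] := bD t v Uv.
  apply: (@continuous_comp _ _ _ f (b t)); first exact: fk.
  exact/differentiable_continuous/derivable1_diffP.
have [df pf] := fk; split=> [v Uv|i].
  by have [] := partial_comp1 (bD t v Uv) (df v Uv).
apply: (@Ck_eq _ _ (fun v => db t (f v) * partial i f v)) => //.
  by move=> v Uv; have [_ ->] := partial_comp1 (bD t v Uv) (df v Uv).
apply: CkM => //; last exact: pf.
by apply: dbC => [t'|]; [apply: IH|]; exact: CkS.
Qed.

Lemma Ck_expR k U f : open U -> Ck k U f -> Ck k U (fun v => expR (f v)).
Proof.
move=> oU fk.
apply: (@Ck_comp1 unit (fun _ => expR) (fun _ => expR) k U f) => //.
by move=> _ k' /(_ tt).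
Qed.

Lemma Ck_inv k U f : open U -> (forall v, U v -> f v != 0) -> Ck k U f ->
  Ck k U (fun v => (f v)^-1).
Proof.
move=> oU f0 fk.
apply: (@Ck_comp1 unit (fun _ x => x^-1) (fun _ x =>
  - (x^-1 * x^-1)) k U f) => //.
- move=> _ v Uv; split; first exact: derivableV (f0 v Uv) _.
  by rewrite deriveV ?f0// derive_id [_ *: _]mulr1 expr2 invfM.
- by move=> _ k' bk _; apply: CkN => //; apply: CkM => //; exact: (bk tt).
Qed.

Lemma Ck_ln k U f : open U -> (forall v, U v -> 0 < f v) -> Ck k U f ->
  Ck k U (fun v => ln (f v)).
Proof.
move=> oU f0 fk.
apply: (@Ck_comp1 unit (fun _ => @ln R) (fun _ x => x^-1) k U f oU) => //.
  by move=> _ v Uv; exact/is_derive1_ln/f0.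
by move=> _ k' _ fk'; apply: Ck_inv => // v Uv; rewrite gt_eqF// f0.
Qed.
End CkCalculus.


(** * The function exp(-1/x) *)

Section FlatFunction.
Context {R : realType}.

(** The functions x^-p exp (-1/x), extended by zero. Those with [p > 0] serve
    to express the derivatives of the one with [p = 0]. *)
Definition flat_fun (p : nat) (x : R) : R :=
  if 0 < x then x^-1 ^+ p * expR (- x^-1) else 0.

Lemma flat_fun_ge0 p x : 0 <= flat_fun p x.
Proof.
rewrite /flat_fun; case: ifP => // x0.
by rewrite mulr_ge0 ?expR_ge0// exprn_ge0// invr_ge0 ltW.
Qed.

Lemma flat_fun_gt0 p x : 0 < x -> 0 < flat_fun p x.
Proof.
move=> x0; rewrite /flat_fun x0.
by rewrite mulr_gt0 ?expR_gt0// exprn_gt0// invr_gt0.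
Qed.

Lemma flat_fun_le0 p x : x <= 0 -> flat_fun p x = 0.
Proof. by rewrite leNgt /flat_fun => /negbTE ->. Qed.

(** With m = p + 2 and y = 1/x, the bound says (y/m)^m <= exp y, and this
    follows from y/m <= 1 + y/m <= exp (y/m). *)
Lemma flat_fun_bound p x : `|flat_fun p x| <= p.+2%:R ^+ p.+2 * x ^+ 2.
Proof.
rewrite ger0_norm ?flat_fun_ge0// /flat_fun; case: ifPn => [x0|_]; last first.
  by rewrite mulr_ge0// ?sqr_ge0// exprn_ge0.
have y0 : 0 < x^-1 by rewrite invr_gt0.
have m0 : 0 < p.+2%:R :> R by [].
have e1 : (x^-1 / p.+2%:R) ^+ p.+2 <= expR (x^-1).
  rewrite -[leRHS](_ : expR (p.+2%:R * (x^-1 / p.+2%:R)) = _); last first.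
    by rewrite mulrC divfK// gt_eqF.
  rewrite expRM_natl lerXn2r ?nnegrE ?expR_ge0//;
    first by rewrite ltW// divr_gt0.
  by apply: le_trans (expR_ge1Dx _); rewrite lerDr.
rewrite expRN ler_pdivrMr ?expR_gt0//.
apply: le_trans (ler_wpM2l _ e1); last first.
  by rewrite mulr_ge0// ?sqr_ge0// exprn_ge0.
have xn0 : x != 0 by rewrite gt_eqF.
have mn0 : p.+2%:R ^+ p.+2 != 0 :> R by rewrite expf_neq0 ?gt_eqF.
rewrite expr_div_n [x^-1 ^+ p.+2]exprS [x^-1 ^+ p.+1]exprS.
rewrite le_eqVlt; apply/orP; left; apply/eqP.
move: (x^-1 ^+ p) (p.+2%:R ^+ p.+2) mn0 => y M M0. by field; rewrite M0 xn0.
Qed.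

(** At the origin the derivative exists and vanishes because the function is
    bounded by a multiple of the square of [x]. *)
Lemma is_derive_flat_fun p (x : R) : is_derive x 1 (flat_fun p)
  (flat_fun p.+2 x - p%:R * flat_fun p.+1 x).
Proof.
have [x0|x0|->] := ltgtP x 0.
- rewrite !flat_fun_le0 1?ltW// mulr0 subr0.
  apply: near_eq_is_derive (is_derive_cst 0 x 1).
  by apply: filterS (lt_nbhsl x0) => y y0; rewrite flat_fun_le0// ltW.
- have xn0 : x != 0 by rewrite gt_eqF.
  have dV : is_derive x 1 (fun y : R => y^-1) (- x^-1 ^+ 2).
    split; first exact: derivableV.
    by rewrite deriveV// derive_id [_ *: _]mulr1 exprVn.
  apply: (@near_eq_is_derive _ _ _ (fun y : R => y^-1 ^+ p * expR (- y^-1))).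
    have : nbhs x [set y | 0 < y] by apply: open_nbhs_nbhs; split=> //;
      exact: open_gt.
    by apply: filterS => y y0; rewrite /flat_fun ifT.
  have dN : is_derive x 1 (fun y : R => - y^-1) (x^-1 ^+ 2).
    by rewrite -[x^-1 ^+ 2]opprK; exact: is_deriveN.
  have dE : is_derive x 1 (fun y : R =>
    expR (- y^-1)) (expR (- x^-1) * x^-1 ^+ 2).
    exact: (@is_derive1_comp R expR (fun y : R => - y^-1)).
  have dX : is_derive x 1 (fun y : R =>
    y^-1 ^+ p) (p%:R * x^-1 ^+ p.-1 * - x^-1 ^+ 2).
    by have := is_deriveX p dV; rewrite exprfctE.
  apply: is_derive_eq (is_deriveM dX dE) _.
  rewrite /flat_fun x0 /= /GRing.scale /=.
  by case: (p) => [|q]; rewrite ?mul0r /= !exprS; ring.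
- rewrite !flat_fun_le0// mulr0 subr0.
  have [] := @differentiable_expansion R R R (flat_fun p) \0 0.
  + exact: cst_continuous.
  + move=> e e0; set C : R := p.+2%:R ^+ p.+2.
    have C0 : 0 < C by rewrite exprn_gt0.
    have eC0 : 0 < e / C by rewrite divr_gt0.
    have : \forall h \near (0 : R), `|h| < e / C.
      by apply/nbhs_ballP; exists (e / C) => // h;
        rewrite -ball_normE /= sub0r normrN.
    apply: filterS => h hC; rewrite addr0 (@flat_fun_le0 p 0)// !subr0.
    apply: le_trans (flat_fun_bound p h) _; rewrite -/C -real_normK ?num_real//.
    by rewrite expr2 mulrA ler_wpM2r// mulrC -ler_pdivlMr// ltW.
  move=> df dE; split; first exact/derivable1_diffP.
  by rewrite deriveE// dE.
Qed.
End FlatFunction.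

(** * Composition of C^k functions *)

Section MoreCk.
Context {R : realType}.

Lemma Ck_flat_fun n k (U : set 'rV[R]_n) (f : 'rV[R]_n -> R) p :
  open U -> Ck k U f -> Ck k U (fun v => flat_fun p (f v)).
Proof.
move=> oU fk; apply: (@Ck_comp1 _ _ nat (@flat_fun R)
  (fun q x => flat_fun q.+2 x - q%:R * flat_fun q.+1 x) k U f oU) =>
    // [q v _|].
  exact: is_derive_flat_fun.
move=> q k' bk _; apply: CkB => //; apply: CkM => //; exact: Ck_cst.
Qed.

(** The order [k.+1] of the components makes [T] differentiable, and so
    continuous, even for [k = 0]. *)
Lemma Ck_comp m n k (U : set 'rV[R]_m) (V : set 'rV[R]_n)
    (T : 'rV[R]_m -> 'rV[R]_n) (f : 'rV[R]_n -> R) :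
  open U -> open V -> (forall v, U v -> V (T v)) ->
  (forall j, Ck k.+1 U (fun v => T v 0 j)) -> Ck k V f ->
  Ck k U (fun v => f (T v)).
Proof.
move=> oU oV UV; elim: k f => [|k IH] f Tk fk.
  move=> v Uv; apply: (@continuous_comp _ _ _ T f); last exact/fk/UV.
  apply/differentiable_continuous/differentiable_rV => j.
  by have [+ _] := Tk j; apply.
have [df pf] := fk; have dT v j : U v -> differentiable (fun u => T u 0 j) v.
  by move=> Uv; have [+ _] := Tk j; apply.
split=> [v Uv|i].
  by have [] := partial_comp (fun j => dT v j Uv) (df _ (UV _ Uv)).
apply: (@Ck_eq _ _ _ _ (fun v =>
    \sum_j partial j f (T v) * partial i (fun u => T u 0 j) v)) => //.
  by move=> v Uv; have [_ ->] := partial_comp (fun j =>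
    dT v j Uv) (df _ (UV _ Uv)).
apply: Ck_sum => // j; apply: CkM => //.
  by apply: IH => [j'|]; [exact: CkS|exact: pf].
by apply: CkS; exact: (proj2 (Tk j) i).
Qed.

End MoreCk.

(** * The mean value theorem on segments *)

Section Segment.
Context {R : realType} {n : nat}.
Implicit Types (f : 'rV[R]_n -> R) (v h : 'rV[R]_n).

Lemma is_derive_line f v h (t : R) : derivable f (t *: h + v) h ->
  is_derive t 1 (fun s : R => f (s *: h + v)) ('D_h f (t *: h + v)).
Proof.
move=> df; have E : (fun s : R => s^-1 *:
    (((fun s : R => f (s *: h + v)) \o shift t) (s *: 1) - f (t *: h + v))) =
    (fun s : R => s^-1 *: ((f \o shift (t *: h + v)) (s *: h) - f (t *: h +
      v))).
  apply/funext => s /=; congr (_ *: (f _ - _)).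
  by rewrite [_ *: 1]mulr1 scalerDl addrA.
by split; [rewrite /derivable E|rewrite /derive E].
Qed.

Lemma MVT_line f v h :
  (forall t : R, 0 <= t <= 1 -> derivable f (t *: h + v) h) ->
  exists2 c : R, 0 <= c <= 1 & f (h + v) - f v = 'D_h f (c *: h + v).
Proof.
move=> df; have d (t : R) : 0 <= t <= 1 ->
  is_derive t 1 (fun s : R => f (s *: h + v))
    ('D_h f (t *: h + v)) by move=> /df /is_derive_line.
have [||c] := @MVT_segment R (fun s : R => f (s *: h + v))
    (fun t => 'D_h f (t *: h + v)) 0 1 ler01.
- by move=> t; rewrite in_itv /= => /andP[t0 t1]; apply: d; rewrite !ltW.
- apply: derivable_within_continuous => t; rewrite in_itv /= => /d dt.
  exact: ex_derive.
rewrite in_itv /= => c01; rewrite scale1r scale0r add0r subr0 mulr1 => E.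
by exists c.
Qed.

Lemma ball_segment (p v h : 'rV[R]_n) (r t : R) :
  ball p r v -> ball p r (h + v) -> 0 <= t <= 1 -> ball p r (t *: h + v).
Proof.
rewrite -ball_normE /= => pv phv /andP[t0 t1].
rewrite (_ : p - (t *: h + v) = t *: (p - (h + v)) + (1 - t) *: (p - v));
  last first.
  by apply/rowP => j; rewrite !mxE; ring.
apply: le_lt_trans (ler_normD _ _) _; rewrite !normrZ ger0_norm//.
rewrite ger0_norm ?subr_ge0//.
have [->|tn0] := eqVneq t 0; first by rewrite mul0r add0r subr0 mul1r.
rewrite (_ : r = t * r + (1 - t) * r); last by ring.
apply: ltr_leD; first by rewrite ltr_pM2l// lt_def tn0.
by rewrite ler_wpM2l ?subr_ge0// ltW.
Qed.

Lemma gradient0_constant f (p : 'rV[R]_n) (r : R) :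
  (forall v, ball p r v -> differentiable f v /\ forall i, partial i f v = 0) ->
  forall v, ball p r v -> f v = f p.
Proof.
move=> df v pv; have pp : ball p r p.
  by apply: ballxx; move: pv; rewrite -ball_normE /=; exact: le_lt_trans.
have b (t : R) : 0 <= t <= 1 -> ball p r (t *: (v - p) + p).
  by apply: ball_segment => //; rewrite subrK.
have [|c /b/df[dc pc]] := @MVT_line f p (v - p).
  by move=> t /b/df[+ _]; exact: diff_derivable.
rewrite subrK derive_partials// big1 => [/eqP|i _]; last by rewrite pc mulr0.
by rewrite subr_eq0 => /eqP.
Qed.
End Segment.

(** * The maximum norm of row vectors *)

Section RowNorm.
Context {R : realType} {n : nat}.

Lemma row_norm_le (x : 'rV[R]_n) (e : R) :
  0 <= e -> (forall j, `|x 0 j| <= e) -> `|x| <= e.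
Proof.
move=> e0 xe; rewrite /Num.norm/= mx_normrE; apply: bigmax_le => // -[i j] _ /=.
by rewrite ord1.
Qed.

Lemma row_norm_coord (x : 'rV[R]_n) j : `|x 0 j| <= `|x|.
Proof.
by rewrite {2}/Num.norm/= mx_normrE; exact: (le_bigmax _ _ (0, j)).
Qed.

Lemma row_closed_ball_compact (p : 'rV[R]_n) (r : R) : 0 < r ->
  compact (closed_ball p r).
Proof.
move=> r0; apply: bounded_closed_compact; last exact: closed_ball_closed.
exists (`|p| + r); split; first exact: num_real.
move=> M pM v; rewrite closed_ballE//= => pv; apply: le_trans (ltW pM).
rewrite -[v](subKr p); apply: le_trans (ler_normB _ _) _.
by rewrite lerD2l.
Qed.
End RowNorm.

(** * Symmetry of the second derivatives *)

Section Translate.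
Context {R : realType} {n : nat}.

Lemma is_derive_translate (f : 'rV[R]_n -> R) (w x h : 'rV[R]_n) :
  derivable f (w + x) h ->
  is_derive x h (fun u => f (w + u)) ('D_h f (w + x)).
Proof.
have E : (fun t : R => t^-1 *:
    (((fun u => f (w + u)) \o shift x) (t *: h) - f (w + x))) =
    (fun t : R => t^-1 *: ((f \o shift (w + x)) (t *: h) - f (w + x))).
  by apply/funext => t /=; rewrite addrCA.
by move=> df; split; [rewrite /derivable E|rewrite /derive E].
Qed.
End Translate.

Section Schwarz.
Context {R : realType} {n : nat}.
Implicit Types (f : 'rV[R]_n -> R) (v : 'rV[R]_n) (U : set 'rV[R]_n).

(** The mean value theorem is applied twice: in direction [i] to the increment
    of [f] in direction [j], then in direction [j] to the i-th partial
    derivative. *)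
Lemma second_difference f v (r s : R) (i j : 'I_n) :
  Ck 2 (ball v r) f -> 0 < s -> 2 * s < r ->
  exists2 p, `|v - p| <= 2 * s &
    f (s *: delta_mx 0 i + (s *: delta_mx 0 j + v)) - f (s *: delta_mx 0 i + v)
      - (f (s *: delta_mx 0 j + v) - f v) =
    s * (s * partial j (partial i f) p).
Proof.
move=> [df pf] s0 sr; set ei : 'rV[R]_n := delta_mx 0 i.
set ej : 'rV[R]_n := delta_mx 0 j.
have ne k : `|delta_mx 0 k : 'rV[R]_n| <= 1.
  by apply: row_norm_le => // a; rewrite !mxE; case: (_ && _);
    rewrite ?normr1 ?normr0.
have nse k (a : R) : 0 <= a <= 1 -> `|a *: (s *: delta_mx 0 k) : 'rV[R]_n| <= s.
  move=> /andP[a0 a1]; rewrite !normrZ (ger0_norm a0) (gtr0_norm s0).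
  by rewrite (le_trans (ler_piMl _ a1)) ?mulr_ge0 ?(ltW s0)// ler_piMr ?ne//
    ltW.
have near_v (a b : R) : 0 <= a <= 1 -> 0 <= b <= 1 ->
    `|v - (b *: (s *: ej) + (a *: (s *: ei) + v))| <= 2 * s.
  move=> a01 b01; rewrite distrC addrA addrK.
  apply: le_trans (ler_normD _ _) _.
  by rewrite mulr2n mulrDl mul1r; apply: lerD; exact: nse.
have in_ball (a b : R) : 0 <= a <= 1 -> 0 <= b <= 1 ->
    ball v r (b *: (s *: ej) + (a *: (s *: ei) + v)).
  by move=> a01 b01; rewrite -ball_normE; apply: le_lt_trans sr; exact: near_v.
have i0 : 0 <= (0 : R) <= 1 by rewrite lexx ler01.
have i1 : 0 <= (1 : R) <= 1 by rewrite lexx ler01.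
pose phi (u : 'rV[R]_n) := f (s *: ej + u) - f u.
have dsh (u h : 'rV[R]_n) : differentiable f (s *: ej + u) ->
  differentiable f u ->
    is_derive u h phi ('D_h f (s *: ej + u) - 'D_h f u).
  move=> d1 d2; apply: is_deriveB; last exact/derivableP/diff_derivable.
  exact/is_derive_translate/diff_derivable.
have ball0 (a : R) : 0 <= a <= 1 -> ball v r (a *: (s *: ei) + v).
  by move=> a01; have := in_ball a 0 a01 i0; rewrite scale0r add0r.
have ball1 (a : R) : 0 <= a <= 1 -> ball v r (s *: ej + (a *: (s *: ei) + v)).
  by move=> a01; have := in_ball a 1 a01 i1; rewrite scale1r.
have [t t01|c c01] := @MVT_line R n phi v (s *: ei).
  have [] := dsh (t *: (s *: ei) + v) (s *: ei); by [apply: df;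
    exact: ball1|apply: df; exact: ball0|].
rewrite /phi.
have [_ ->] := dsh (c *: (s *: ei) + v) (s *: ei) (df _ (ball1 _ c01)) (df _
  (ball0 _ c01)).
have Ds k u : ball v r u -> 'D_(s *: delta_mx 0 k) f u = s * partial k f u.
  by move=> bu; rewrite deriveE ?linearZ -?deriveE//; exact: df.
rewrite !Ds; [|exact: ball0|exact: ball1].
have [dpf _] := pf i.
have [t t01|c' c01'] := @MVT_line R n (partial i f) (c *: (s *: ei) + v) (s *:
  ej).
  by apply: diff_derivable; apply: dpf; exact: in_ball.
have Dsi k u : ball v r u -> 'D_(s *: delta_mx 0 k) (partial i f) u =
  s * partial k (partial i f) u.
  by move=> bu; rewrite deriveE ?linearZ -?deriveE//; exact: dpf.
rewrite Dsi; last exact: in_ball.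
move=> E1 E2; exists (c' *: (s *: ej) + (c *: (s *: ei) + v));
  first exact: near_v.
by rewrite -E1 mulrBr -E2 addrCA.
Qed.

(** The second difference of [f] is symmetric in [i] and [j]. By
    [second_difference], a value of one mixed derivative at a point close to
    [v] is therefore a value of the other one at another such point; both are
    continuous. *)
Lemma schwarz f U v i j : open U -> U v -> Ck 2 U f ->
  partial i (partial j f) v = partial j (partial i f) v.
Proof.
move=> oU Uv f2; have /nbhs_ballP[r /= r0 rU] : nbhs v U by exact:
  open_nbhs_nbhs.
have fr : Ck 2 (ball v r) f by exact: Ck_sub f2.
have cp k l : {for v, continuous (partial k (partial l f))}.
  by case: f2 => _ /(_ l)[_ /(_ k)]; apply.
apply/eqP; rewrite -subr_eq0 -normr_le0; apply/ler_addgt0Pl => e e0.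
rewrite addr0.
have e20 : 0 < e / 2 by rewrite divr_gt0.
have /cvgrPdist_le/(_ _ e20)/nbhs_ballP[d1 /= d10 h1] := cp i j.
have /cvgrPdist_le/(_ _ e20)/nbhs_ballP[d2 /= d20 h2] := cp j i.
(* The points of [second_difference] are at distance at most 2 s from v. *)
pose s := Num.min r (Num.min d1 d2) / 4.
have m0 : 0 < Num.min r (Num.min d1 d2) by rewrite !lt_min r0 d10 d20.
have s0 : 0 < s by rewrite divr_gt0.
have s2 : 2 * s < Num.min r (Num.min d1 d2).
  by rewrite /s mulrC -mulrA gtr_pMr//; lra.
move: s2; rewrite !lt_min => /and3P[sr sd1 sd2].
have [p vp Ep] := second_difference i j fr s0 sr.
have [q vq Eq] := second_difference j i fr s0 sr.
have sn0 : s != 0 by rewrite gt_eqF.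
have tri (a b c : R) : `|a - c| <= e / 2 -> `|b - c| <= e / 2 -> `|a - b| <= e.
  move=> ac bc; rewrite [e]splitr -(subrKA c);
    apply: le_trans (ler_normD _ _) _.
  by apply: lerD => //; rewrite distrC.
have aux (a b c d : R) : a - b - (c - d) = a - c - (b - d) by ring.
have Epq : partial j (partial i f) p = partial i (partial j f) q.
  apply: (mulfI sn0); apply: (mulfI sn0).
  apply: etrans (esym Ep) _; apply: etrans Eq.
  rewrite [s *: delta_mx 0 i + (_ + v)]addrCA.
  exact: aux.
have := h1 q _; have := h2 p _;
  rewrite -ball_normE /= => /(_ (le_lt_trans vp sd2)) hp.
move=> /(_ (le_lt_trans vq sd1)) hq.
rewrite -Epq in hq; exact: tri hq hp.
Qed.
End Schwarz.

(** * Differentiation under the integral sign *)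

Section Leibniz.
Context {R : realType}.

Definition integral01 (f : R -> R) : R :=
  \int[@lebesgue_measure R]_(t in `[0, 1]%classic) f t.

(** Leibniz' rule at the parameter 0, for an integrand whose derivative there
    has a known primitive [F], so that the resulting integral can be
    evaluated. *)
Lemma is_derive_integral01 (f df : R -> R -> R) (F : R -> R) (d M : R) :
  0 < d ->
  (forall s t : R, `|s| < d -> 0 <= t <= 1 ->
    is_derive s 1 (f ^~ t) (df s t)) ->
  (forall s t : R, `|s| < d -> 0 <= t <= 1 -> `|df s t| <= M) ->
  (forall s : R, `|s| < d -> {within `[0, 1], continuous (f s)}) ->
  (forall t : R, 0 <= t <= 1 -> is_derive t 1 F (df 0 t)) ->
  {within `[0, 1], continuous (df 0)} ->
  is_derive (0 : R) 1 (fun s => integral01 (f s)) (F 1 - F 0).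
Proof.
move=> d0 fD dfM fC FD dfC.
have Id s : `]- d, d[%classic s -> `|s| < d by rewrite /= in_itv /= ltr_norml.
have I0 : `]- d, d[%classic (0 : R) by rewrite /= in_itv /= oppr_lt0 d0.
have B01 (t : R) : `[0, 1]%classic t -> 0 <= t <= 1 by rewrite /= in_itv.
have M0 : 0 <= M.
  by apply: le_trans (dfM 0 0 _ _); rewrite ?normr0// lexx ler01.
have intf s : `]- d, d[%classic s ->
    (@lebesgue_measure R).-integrable `[0, 1]%classic (EFin \o f s).
  by move=> /Id ds; apply: continuous_compact_integrable (fC s ds);
    exact: segment_compact.
have derf s t : `]- d, d[%classic s -> `[0,
  1]%classic t -> derivable (f ^~ t) s 1.
  by move=> /Id ds /B01 t01; have [] := fD s t ds t01.
have intM : (@lebesgue_measure R).-integrable `[0, 1]%classic (EFin \o (cst M)).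
  apply: continuous_compact_integrable; first exact: segment_compact.
  by apply: continuous_subspaceT => x; exact: cst_continuous.
have Mub s t : `]- d, d[%classic s -> `[0,
  1]%classic t -> `|(f ^~ t)^`() s| <= M.
  move=> /Id ds /B01 t01; rewrite derive1E.
  by have [_ ->] := fD s t ds t01; exact: dfM.
have mB : measurable (`[0, 1]%classic : set R) by [].
split.
  exact: (@derivable_under_integral R _ _ (@lebesgue_measure R) f _ mB 0 (- d) d
    I0 intf derf (cst M) (fun _ => M0) intM Mub).
rewrite -derive1E.
rewrite (@differentiation_under_integral R _ _ (@lebesgue_measure R) f _ mB 0
  (- d) d
    I0 intf derf (cst M) (fun _ => M0) intM Mub).
transitivity (integral01 (df 0)).
  apply: eq_Rintegral => t; rewrite inE => /B01 t01;
    rewrite /partial1of2 derive1E.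
  have d0' : `|0 : R| < d by rewrite normr0.
  by have [_ ->] := fD 0 t d0' t01.
have FC (t : R) : 0 <= t <= 1 -> {for t, continuous F}.
  move=> /FD[FDt _]; exact/differentiable_continuous/derivable1_diffP.
have i0 : 0 <= (0 : R) <= 1 by rewrite lexx ler01.
have i1 : 0 <= (1 : R) <= 1 by rewrite lexx ler01.
rewrite /integral01 /Rintegral (@continuous_FTC2 _ (df 0) F)//.
- split.
  + move=> t; rewrite in_itv /= => /andP[t0 t1].
    by have [] := FD t; rewrite ?(ltW t0) ?(ltW t1).
  + exact/cvg_at_right_filter/FC.
  + exact/cvg_at_left_filter/FC.
- move=> t; rewrite in_itv /= => /andP[t0 t1].
  by rewrite derive1E; have [] := FD t; rewrite ?(ltW t0) ?(ltW t1).
Qed.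
End Leibniz.

(** * From directional derivatives to the differential *)

Section Gateaux.
Context {R : realType} {n : nat}.
Implicit Types (w : 'I_n -> 'rV[R]_n -> R).

(** A 1-form with components [w], evaluated at [x] on the vector [u]. *)
Definition pairing w (u x : 'rV[R]_n) : R := \sum_i u 0 i * w i x.

Lemma pairingD w u u' x : pairing w (u + u') x = pairing w u x + pairing w u' x.
Proof.
by rewrite /pairing -big_split; apply: eq_bigr => i _; rewrite mxE mulrDl.
Qed.

Lemma pairingZ w t u x : pairing w (t *: u) x = t * pairing w u x.
Proof.
by rewrite /pairing mulr_sumr; apply: eq_bigr => i _; rewrite mxE mulrA.
Qed.

Lemma pairing_delta w i x : pairing w (delta_mx 0 i) x = w i x.
Proof.
rewrite /pairing (bigD1 i)//= mxE !eqxx mul1r big1 ?addr0// => j ji.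
by rewrite mxE (negbTE ji) andbF mul0r.
Qed.

Lemma Ck_pairing k U w u : open U -> (forall i, Ck k U (w i)) ->
  Ck k U (pairing w u).
Proof.
by move=> oU wk; apply: Ck_sum => // i; apply: CkM => //; exact: Ck_cst.
Qed.

(** By the mean value theorem, g (h + v) - g v is the value of the form [w] on
    [h] at a point of the segment from [v] to [h + v], and [w] is continuous
    at [v]. *)
Lemma differentiable_gateaux (g : 'rV[R]_n -> R) w (v : 'rV[R]_n) :
  (forall i, {for v, continuous (w i)}) ->
  (\forall x \near v, forall h, is_derive x h g (pairing w h x)) ->
  differentiable g v /\ forall i, partial i g v = w i v.
Proof.
move=> wC /nbhs_ballP[r /= r0 gD].
have Llin : linear (pairing w ^~ v : 'rV[R]_n -> R).
  by move=> a u u'; rewrite /= pairingD pairingZ.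
pose LM := GRing.isLinear.Build _ _ _ _ _ Llin.
pose L : {linear 'rV[R]_n -> R} := HB.pack (pairing w ^~ v : 'rV[R]_n -> R) LM.
have Lc : continuous L.
  have Ck0 : Ck 0 setT (pairing w ^~ v).
    by apply: Ck_sum => [|i]; [exact: openT|
      apply: CkM; [exact: openT|exact/Ck_coord/openT|exact/Ck_cst/openT]].
  by move=> u; exact: (Ck0 u I).
suff H (e : R) : 0 < e -> \forall h \near (0 : 'rV[R]_n),
    `|g (h + v) - g v - L h| <= e * `|h|.
  have [dg dgE] := differentiable_expansion Lc H.
  by split=> // i; rewrite /partial deriveE// dgE /L /= pairing_delta.
move=> e0; pose e' := e / n.+1%:R.
have e'0 : 0 < e' by rewrite divr_gt0.
have wn : \forall x \near v, forall i, `|w i v - w i x| <= e'.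
  apply: (@filter_forall _ _ (fun i =>
    [set x | `|w i v - w i x| <= e']) _ (nbhs_filter v)) => i.
  by have /cvgrPdist_le/(_ _ e'0) := wC i.
have /nbhs_ballP[d /= d0 dw] := wn.
have m0 : 0 < Num.min d r by rewrite lt_min d0 r0.
apply/nbhs_ballP; exists (Num.min d r) => // h.
rewrite -ball_normE /= sub0r normrN lt_min => /andP[hd hr].
have hv (t : R) : 0 <= t <= 1 -> ball v d (t *: h + v) /\ ball v r (t *: h + v).
  move=> t01; suff H s : 0 < s -> `|h| < s -> ball v s (t *: h + v).
    by split; apply: H.
  move=> s0 hs; apply: ball_segment => //; first exact: ballxx.
  by rewrite -ball_normE /= opprD addrCA subrr addr0 normrN.
have [t /hv[_ tr]|c /hv[cd cr] ->] := @MVT_line _ _ g v h.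
  by have [] := gD _ tr h.
have [_ ->] := gD _ cr h; rewrite /L /= /pairing -sumrB.
apply: le_trans (ler_norm_sum _ _ _) _.
apply: (@le_trans _ _ (\sum_(i < n) `|h| * e')).
  apply: ler_sum => i _; rewrite -mulrBr normrM.
  apply: ler_pM => //; first exact: row_norm_coord.
  by rewrite distrC; exact: dw.
rewrite sumr_const card_ord -mulrnAr mulrC ler_wpM2r// /e' -mulr_natr.
rewrite mulrAC ler_pdivrMr// ler_pM2l// ler_nat.
exact: leqnSn.
Qed.
End Gateaux.

(** * Poincare's lemma on a ball *)

Section Poincare.
Context {R : realType} {n : nat}.

Lemma bounded_on_closed_ball (A : 'rV[R]_n -> R) (p : 'rV[R]_n) (r r' : R) :
  0 < r' < r -> (forall x, ball p r x -> {for x, continuous A}) ->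
  exists M, forall x, `|p - x| <= r' -> `|A x| <= M.
Proof.
move=> /andP[r'0 r'r] cA; pose K := closed_ball p r'.
have KE : K = [set x | `|p - x| <= r'] by rewrite /K closed_ballE.
have cK : compact K by exact: row_closed_ball_compact.
have K0 : K !=set0 by exists p; rewrite KE /= subrr normr0 ltW.
have [|c _ cM] := @EVT_max_rV R n (fun x => `|A x|) K K0 cK.
  apply: continuous_in_subspaceT => x; rewrite inE KE /= => px.
  apply: continuous_comp; last exact: norm_continuous.
  by apply: cA; rewrite -ball_normE /=; exact: le_lt_trans r'r.
by exists `|A c| => x px; apply: cM; rewrite inE KE.
Qed.

Variables (p : 'rV[R]_n) (r : R) (w : 'I_n -> 'rV[R]_n -> R).
Let B := ball p r.
Hypothesis w2 : forall i, Ck 2 B (w i).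
Hypothesis w_closed : forall i j v,
  B v -> partial i (w j) v = partial j (w i) v.

Let oB : open B. Proof. exact: ball_open. Qed.

Let dW u x : B x -> differentiable (pairing w u) x.
Proof. by have /= [+ _] := Ck_pairing u oB w2; apply. Qed.

(** Closedness, as a symmetry in two arbitrary directions. *)
Let W_sym h u x : B x -> 'D_h (pairing w u) x = 'D_u (pairing w h) x.
Proof.
have D a b : B x -> 'D_a (pairing w b) x =
    \sum_j \sum_i a 0 j * (b 0 i * partial j (w i) x).
  move=> Bx; rewrite derive_partials; last exact: dW.
  apply: eq_bigr => j _; rewrite -mulr_sumr; congr (_ * _).
  have dw i : differentiable (w i) x by have [+ _] := w2 i; apply.
  rewrite /pairing /partial.
  rewrite (_ : (fun x => _) = \sum_(i < n) (fun x => b 0 i * w i x));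
    last first.
    by apply/funext => y; rewrite fct_sumE.
  rewrite derive_sum => [|i]; last first.
    by apply: derivableM; [exact: derivable_cst|exact/diff_derivable].
  by apply: eq_bigr => i _; apply: deriveMl; exact/diff_derivable.
move=> Bx; rewrite !D// exchange_big; apply: eq_bigr => j _.
by apply: eq_bigr => i _; rewrite w_closed// mulrCA.
Qed.

Let CDW h u x : B x -> {for x, continuous (fun y => 'D_h (pairing w u) y)}.
Proof.
move=> Bx; have Wk : Ck 1 B (pairing w u) by apply: Ck_pairing => // i;
  exact: CkS.
have W2 : Ck 2 B (pairing w u) by exact: Ck_pairing.
have [_ pW] := W2.
have : Ck 0 B (fun y => \sum_j h 0 j * partial j (pairing w u) y).
  by apply: Ck_sum => // j; apply: CkM => //; [exact: Ck_cst|exact/CkS/pW].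
move=> /(Ck_eq oB); apply => // y By.
by rewrite derive_partials//; exact: dW.
Qed.

(** The integral of [w] along the segment from [p] to [v]. *)
Definition cone_potential (v : 'rV[R]_n) : R :=
  integral01 (fun t => pairing w (v - p) (t *: (v - p) + p)).

(** Let u = v - p. The derivative in direction [h] of the integrand w(p + t
    u)(u) is t D_h w(u) + w(h), which equals t D_u w(h) + w(h) because [w] is
    closed; this is the derivative of t w(p + t u)(h) with respect to t. *)
Let cone_potentialD v h : B v -> is_derive v h cone_potential (pairing w h v).
Proof.
rewrite /B -ball_normE /= distrC; set u := v - p => ur.
(* For |s| < d and t in [0, 1], the point p + t (u + s h) stays in the closed
   ball of radius r', on which the derivative of the integrand is bounded. *)
pose r' := (`|u| + r) / 2.
have ur' : `|u| < r' by rewrite /r'; lra.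
have r'r : r' < r by rewrite /r'; lra.
have r'0 : 0 < r' by apply: le_lt_trans ur'.
pose d := (r' - `|u|) / (`|h| + 1).
have h1 : 0 < `|h| + 1 by rewrite ltr_wpDl.
have d0 : 0 < d by rewrite divr_gt0// subr_gt0.
pose c (s t : R) := t *: (s *: h + u) + p.
have cK (s t : R) : `|s| < d -> 0 <= t <= 1 -> `|p - c s t| <= r'.
  move=> sd /andP[t0 t1]; rewrite distrC /c addrK normrZ ger0_norm//.
  apply: le_trans (ler_piMl _ t1) _ => //; apply: le_trans (ler_normD _ _) _.
  rewrite normrZ -lerBrDr; apply: le_trans (_ : d * (`|h| + 1) <= _).
    by apply: ler_pM => //; rewrite ?(ltW sd)// lerDl.
  by rewrite /d divfK// gt_eqF.
have cB (s t : R) : `|s| < d -> 0 <= t <= 1 -> B (c s t).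
  by move=> sd t01; rewrite /B -ball_normE; apply: le_lt_trans r'r; exact: cK.
pose f (s t : R) := pairing w (s *: h + u) (c s t).
pose df (s t : R) := pairing w h (c s t) + s * (t * 'D_h (pairing w h) (c s t))
  + t * 'D_h (pairing w u) (c s t).
have CW a x : B x -> {for x, continuous (pairing w a)}.
  by move=> Bx; exact/differentiable_continuous/dW.
have r'r0 : 0 < r' < r by rewrite r'0.
have [M1 M1P] := bounded_on_closed_ball r'r0 (@CW h).
have [M2 M2P] := bounded_on_closed_ball r'r0 (@CDW h h).
have [M3 M3P] := bounded_on_closed_ball r'r0 (@CDW h u).
have cs (s t : R) : c s t = s *: (t *: h) + (t *: u + p).
  by rewrite /c scalerDr !scalerA mulrC addrA.
have Dline a (s t : R) : `|s| < d -> 0 <= t <= 1 ->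
    is_derive s 1 (fun s : R =>
      pairing w a (c s t)) (t * 'D_h (pairing w a) (c s t)).
  move=> sd t01; have Bc := cB s t sd t01.
  have -> : (fun s : R => pairing w a (c s t)) =
      (fun s : R => pairing w a (s *: (t *: h) + (t *: u + p))).
    by apply/funext => z; rewrite cs.
  have dWc := dW a Bc.
  have -> : t * 'D_h (pairing w a) (c s t) = 'D_(t *: h) (pairing w a) (c s t).
    by rewrite !deriveE// linearZ.
  by rewrite cs; apply: is_derive_line; rewrite -cs; exact: diff_derivable.
have cl (s : R) : forall t : R, {for t, continuous (c s)}.
  move=> t; rewrite /c; apply: cvgD; last exact: cvg_cst.
  by apply: cvgZl; exact: cvg_id.
have Ccomp (A : 'rV[R]_n -> R) (s t : R) : `|s| < d -> 0 <= t <= 1 ->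
    (forall x, B x -> {for x, continuous A}) -> {for t,
      continuous (fun t => A (c s t))}.
  move=> sd t01 cA; apply: (@continuous_comp _ _ _ (c s) A); first exact: cl.
  by apply: cA; exact: cB.
have fE (s t : R) : f s t = pairing w u (c s t) + s * pairing w h (c s t).
  by rewrite /f pairingD pairingZ addrC.
have i00 : `|0 : R| < d by rewrite normr0.
have C0 (t : R) : c 0 t = t *: u + p by rewrite cs scale0r add0r.
have := @is_derive_integral01 R f df (fun t => t * pairing w h (c 0 t)) d
  (M1 + d * M2 + M3) d0.
have H0 (t : R) : 0 <= t <= 1 ->
  is_derive t 1 (fun t => t * pairing w h (c 0 t)) (df 0 t).
  move=> t01; have Bc := cB 0 t i00 t01.
  have dl : is_derive t 1 (fun t =>
    pairing w h (c 0 t)) ('D_u (pairing w h) (c 0 t)).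
    rewrite (_ : (fun t => _) = (fun t : R => pairing w h (t *: u + p)));
      last first.
      by apply/funext => z; rewrite C0.
    rewrite C0; apply: is_derive_line; rewrite -C0; exact/diff_derivable/dW.
  apply: is_derive_eq (is_deriveM (is_derive_id t 1) dl) _.
  rewrite /df mul0r addr0 /= /GRing.scale /= mulr1 addrC; congr (_ + _ * _).
  by rewrite W_sym.
have H1 (s t : R) : `|s| < d -> 0 <= t <= 1 -> is_derive s 1 (f ^~ t) (df s t).
  move=> sd t01.
  rewrite (_ : f ^~ t = (fun s => pairing w u (c s t)) + (fun s =>
    s * pairing w h (c s t))); last first.
    by apply/funext => z; rewrite fE.
  apply: is_derive_eq (is_deriveD (Dline u s t sd t01)
    (is_deriveM (is_derive_id s 1) (Dline h s t sd t01))) _.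
  by rewrite /df /= /GRing.scale /= mulr1 addrC [_ + pairing w h _]addrC.
have H2 (s t : R) : `|s| < d -> 0 <= t <= 1 -> `|df s t| <= M1 + d * M2 + M3.
  move=> sd t01; have /= ck := cK s t sd t01; have /andP[t0 t1] := t01.
  apply: le_trans (ler_normD _ _) _; apply: lerD; last first.
    rewrite normrM (ger0_norm t0); apply: le_trans (ler_piMl _ t1) _ => //;
      exact: M3P.
  apply: le_trans (ler_normD _ _) _; apply: lerD; first exact: M1P.
  rewrite !normrM (ger0_norm t0); apply: ler_pM => //;
    rewrite ?mulr_ge0 ?(ltW sd)//.
  apply: le_trans (ler_piMl _ t1) _ => //; exact: M2P.
have H3 (s : R) : `|s| < d -> {within `[0, 1], continuous (f s)}.
  move=> sd; apply: continuous_in_subspaceT => t;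
    rewrite inE /= in_itv /= => t01.
  rewrite (_ : f s = (fun t =>
    pairing w u (c s t) + s * pairing w h (c s t))); last first.
    by apply/funext => z; rewrite fE.
  apply: cvgD; first by apply: Ccomp => //; exact: CW.
  by apply: cvgM; [exact: cvg_cst|apply: Ccomp => //; exact: CW].
have H4 : {within `[0, 1], continuous (df 0)}.
  apply: continuous_in_subspaceT => t; rewrite inE /= in_itv /= => t01.
  apply: cvgD; [apply: cvgD|apply: cvgM; [exact: cvg_id|]].
  - by apply: Ccomp => //; exact: CW.
  - apply: cvgM; [exact: cvg_cst|apply: cvgM; [exact: cvg_id|]].
    by apply: (Ccomp (fun x => 'D_h (pairing w h) x)) => // x; exact: CDW.
  - by apply: (Ccomp (fun x => 'D_h (pairing w u) x)) => // x; exact: CDW.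
move=> /(_ H1 H2 H3 H0 H4);
  rewrite mul1r mul0r subr0 C0 scale1r /u subrK => -[I1 I2].
have E : (fun s => integral01 (f s)) =
  (fun s : R => cone_potential (s *: h + v)).
  apply/funext => s; rewrite /cone_potential /f /c; congr integral01.
  by apply/funext => t; rewrite addrA.
rewrite E in I1 I2; split;
  first exact: (proj2 (derivable1P cone_potential v h)).
have E2 : (fun s : R => s^-1 *: (((fun s : R => cone_potential (s *: h + v))
      \o shift 0) (s *: 1) - cone_potential (0 *: h + v))) =
    (fun s : R => s^-1 *: ((cone_potential \o shift v) (s *: h) -
      cone_potential v)).
  by apply/funext => s /=; rewrite addr0 scale0r add0r [_ *: 1]mulr1.
by rewrite -I2 /derive E2.
Qed.

Lemma poincare : exists g, forall v, B v ->
  differentiable g v /\ forall i, partial i g v = w i v.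
Proof.
exists cone_potential => v Bv; apply: differentiable_gateaux.
  by move=> i; have [dw _] := w2 i; exact/differentiable_continuous/dw.
have : \forall x \near v, B x by apply: open_nbhs_nbhs; split.
by apply: filterS => x Bx h; exact: cone_potentialD.
Qed.
End Poincare.

(** * Smooth functions on a manifold *)

Section SmoothFunctions.
Context {R : realType} {n : nat} {X : manifold R n}.
Implicit Types (U V : set X) (f g : X -> R) (A : chart_idx X).

Definition chart_image A U : set 'rV[R]_n := chart_map A @` (U `&` chart_dom A).

Lemma chart_imageP A U v : chart_image A U v ->
  [/\ U (chart_inv A v), chart_dom A (chart_inv A v) &
      chart_map A (chart_inv A v) = v].
Proof. by case=> x [Ux Ax] <-; rewrite chart_mapK. Qed.

Lemma chart_image_mem A U x : U x -> chart_dom A x ->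
  chart_image A U (chart_map A x).
Proof. by move=> Ux Ax; exists x. Qed.

Lemma chart_inv_near A x (P : set X) : chart_dom A x ->
  (\near x, P x) -> \forall v \near chart_map A x, P (chart_inv A v).
Proof.
move=> Ax Px; have Av : (chart_map A @` chart_dom A) (chart_map A x) by exists
  x.
by have := chart_inv_continuous Av; apply; rewrite chart_mapK.
Qed.

Lemma chart_map_near A x (P : set 'rV[R]_n) : chart_dom A x ->
  (\forall v \near chart_map A x, P v) ->
  \forall y \near x, P (chart_map A y).
Proof. by move=> Ax Px; have := chart_map_continuous Ax; apply. Qed.

Lemma open_near (T : topologicalType) (U : set T) x : open U -> U x ->
  \forall y \near x, U y.
Proof. by move=> oU Ux; apply: open_nbhs_nbhs; split. Qed.

Lemma chart_exists x : exists A : chart_idx X, chart_dom A x.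
Proof.
have : (\bigcup_A @chart_dom _ _ X A) x by rewrite chart_cover.
by case=> A _ Ax; exists A.
Qed.

Lemma open_chart_image A U : open U -> open (chart_image A U).
Proof.
move=> oU; rewrite openE => _ [x [Ux Ax] <-]; rewrite /interior.
have Av : (chart_map A @` chart_dom A) (chart_map A x) by exists x.
have h1 : \forall v \near chart_map A x, (chart_map A @` chart_dom A) v.
  by apply: open_nbhs_nbhs; split => //; exact: chart_image_open.
have h2 := chart_inv_near Ax (open_near oU Ux).
apply: filterS2 h1 h2 => _ [y Ay <-]; rewrite chart_mapK// => Uy.
by exists y.
Qed.

Lemma smooth_sub U V f : U `<=` V -> smooth_on V f -> smooth_on U f.
Proof.
move=> UV Vf A k; apply: Ck_sub (Vf A k).
by move=> _ [x [Ux Ax] <-]; exact/chart_image_mem/Ax/UV.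
Qed.

Lemma smooth_local U f :
  (forall x, U x -> exists2 V, V x & smooth_on V f) -> smooth_on U f.
Proof.
move=> UV A k; apply: Ck_pointwise => _ [x [Ux Ax] <-].
have [V Vx Vf] := UV x Ux; exists (chart_image A V); last exact: Vf.
exact: chart_image_mem.
Qed.

Lemma smooth_eq U f g : open U -> (forall x, U x -> f x = g x) ->
  smooth_on U f -> smooth_on U g.
Proof.
move=> oU fg Uf A k; apply: Ck_eq (Uf A k); first exact: open_chart_image.
by move=> v /chart_imageP[Uv _ _]; exact: fg.
Qed.

Lemma smooth_cst U c : open U -> smooth_on U (fun _ : X => c).
Proof. by move=> oU A k; apply: Ck_cst; exact: open_chart_image. Qed.

Lemma smoothD U f g : open U -> smooth_on U f -> smooth_on U g ->
  smooth_on U (fun x => f x + g x).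
Proof. by move=> oU Uf Ug A k; apply: CkD;
  [exact: open_chart_image|exact: Uf|exact: Ug]. Qed.

Lemma smoothN U f : open U -> smooth_on U f -> smooth_on U (fun x => - f x).
Proof. by move=> oU Uf A k; apply: CkN;
  [exact: open_chart_image|exact: Uf]. Qed.

Lemma smoothB U f g : open U -> smooth_on U f -> smooth_on U g ->
  smooth_on U (fun x => f x - g x).
Proof. by move=> oU Uf Ug; apply: smoothD => //; exact: smoothN. Qed.

Lemma smoothM U f g : open U -> smooth_on U f -> smooth_on U g ->
  smooth_on U (fun x => f x * g x).
Proof. by move=> oU Uf Ug A k; apply: CkM;
  [exact: open_chart_image|exact: Uf|exact: Ug]. Qed.

Lemma smoothV U f : open U -> (forall x, U x -> f x != 0) -> smooth_on U f ->
  smooth_on U (fun x => (f x)^-1).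
Proof.
move=> oU f0 Uf A k; apply: Ck_inv; [exact: open_chart_image| |exact: Uf].
by move=> v /chart_imageP[Uv _ _]; exact: f0.
Qed.

Lemma smooth_expR U f : open U -> smooth_on U f ->
  smooth_on U (fun x => expR (f x)).
Proof. by move=> oU Uf A k; apply: Ck_expR;
  [exact: open_chart_image|exact: Uf]. Qed.

Lemma smooth_ln U f : open U -> (forall x, U x -> 0 < f x) -> smooth_on U f ->
  smooth_on U (fun x => ln (f x)).
Proof.
move=> oU f0 Uf A k; apply: Ck_ln; [exact: open_chart_image| |exact: Uf].
by move=> v /chart_imageP[Uv _ _]; exact: f0.
Qed.

Lemma smooth_sum U m (F : 'I_m -> X -> R) : open U ->
  (forall j, smooth_on U (F j)) -> smooth_on U (fun x => \sum_j F j x).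
Proof.
by move=> oU Fs A k; apply: Ck_sum => [|j]; [exact: open_chart_image|exact: Fs].
Qed.

Lemma smooth_continuous U f x : smooth_on U f -> U x -> open U ->
  {for x, continuous f}.
Proof.
move=> Uf Ux oU; have [A Ax] := chart_exists x.
have cf : {for chart_map A x, continuous (fun v => f (chart_inv A v))}.
  by apply: (Uf A 0%N); exact: chart_image_mem.
have c : {for x, continuous ((fun v => f (chart_inv A v)) \o chart_map A)}.
  by apply: continuous_comp => //; exact: chart_map_continuous.
rewrite /prop_for /continuous_at -[in f x](chart_mapK Ax).
apply: cvg_trans c; apply: near_eq_cvg.
have := open_near (chart_dom_open A) Ax; apply: filterS => y Ay /=.
by rewrite chart_mapK.
Qed.

(** The transition functions are smooth, so that one chart is enough to test
    smoothness on a subset of its domain. *)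
Lemma smooth_chart U f A : open U -> U `<=` chart_dom A ->
  Cinfty (chart_image A U) (fun v => f (chart_inv A v)) -> smooth_on U f.
Proof.
move=> oU UA Uf A' k.
have oU' : open (chart_image A' U) by exact: open_chart_image.
apply: (@Ck_eq _ _ _ _ (fun v =>
  f (chart_inv A (chart_map A (chart_inv A' v))))) => //.
  by move=> v /chart_imageP[Uv _ _]; rewrite chart_mapK//; exact: UA.
apply: (@Ck_comp _ _ _ _ _ (chart_image A U) (fun v =>
  chart_map A (chart_inv A' v))
  (fun v => f (chart_inv A v))) => //.
- exact: open_chart_image.
- by move=> v /chart_imageP[Uv _ _]; apply: chart_image_mem => //; exact: UA.
- move=> j; apply: Ck_sub (@chart_transition _ _ X A' A j k.+1).
  by move=> _ [x [Ux Ax] <-]; exists x => //; split => //; exact: UA.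
Qed.

Lemma smooth_locally_constant U f : open U -> locally_constant U f ->
  smooth_on U f.
Proof.
move=> oU lc; apply: smooth_local => x Ux.
have : nbhs x [set y | f y = f x] by exact: lc.
rewrite nbhsE => -[V [oV Vx] Vf]; exists V => //.
by apply: smooth_eq (@smooth_cst V (f x) oV) => // y /Vf.
Qed.

End SmoothFunctions.

(** * Differentials of functions and of 1-forms *)

Section Differentials.
Context {R : realType} {n : nat} {X : manifold R n}.
Implicit Types (U V : set X) (f g : X -> R) (A : chart_idx X).

(** A condition in the coordinates of the single chart [A]; [d0_transform]
    carries it over to the other charts at [x]. *)
Definition chart_differentiable A f (x : X) : Prop :=
  differentiable (fun v => f (chart_inv A v)) (chart_map A x).

Lemma smooth_differentiable U f A x : smooth_on U f -> U x -> chart_dom A x ->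
  chart_differentiable A f x.
Proof.
by move=> Uf Ux Ax; have [d _] := Uf A 1%N; apply: d; exact: chart_image_mem.
Qed.

Lemma chart_partial_near_eq A i f g x : chart_dom A x -> (\near x, f x = g x) ->
  chart_partial A i f x = chart_partial A i g x.
Proof. by move=> Ax fg; apply: partial_near_eq;
  exact: (chart_inv_near Ax fg). Qed.

Lemma chart_differentiable_near_eq A f g x : chart_dom A x ->
  (\near x, f x = g x) -> chart_differentiable A f x ->
    chart_differentiable A g x.
Proof.
by move=> Ax fg; apply: near_eq_differentiable; exact: (chart_inv_near Ax fg).
Qed.

Lemma chart_partialN A i f x : chart_differentiable A f x ->
  chart_partial A i (fun y => - f y) x = - chart_partial A i f x.
Proof. exact: partialN. Qed.

Lemma chart_partialD A i f g x :
  chart_differentiable A f x -> chart_differentiable A g x ->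
  chart_partial A i (fun y => f y + g y) x =
  chart_partial A i f x + chart_partial A i g x.
Proof. exact: partialD. Qed.

Lemma chart_partialB A i f g x :
  chart_differentiable A f x -> chart_differentiable A g x ->
  chart_partial A i (fun y => f y - g y) x =
  chart_partial A i f x - chart_partial A i g x.
Proof. exact: partialB. Qed.

Lemma chart_partialM A i f g x : chart_dom A x ->
  chart_differentiable A f x -> chart_differentiable A g x ->
  chart_partial A i (fun y => f y * g y) x =
  f x * chart_partial A i g x + g x * chart_partial A i f x.
Proof.
by move=> Ax df dg; rewrite /chart_partial partialM//= chart_mapK.
Qed.

Lemma chart_partial_ln A i f x : chart_dom A x -> chart_differentiable A f x ->
  0 < f x ->
  chart_partial A i (fun y => ln (f y)) x = (f x)^-1 * chart_partial A i f x.
Proof.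
move=> Ax df f0; pose F v := f (chart_inv A v).
have Fx : F (chart_map A x) = f x by rewrite /F chart_mapK.
have dln : is_derive (F (chart_map A x)) 1 (@ln R) (F (chart_map A x))^-1.
  by apply: is_derive1_ln; rewrite Fx.
by have [_ /(_ i)] := partial_comp1 dln df; rewrite Fx.
Qed.

Lemma d0E A f x i : d0 f A x 0 i = chart_partial A i f x.
Proof. by rewrite mxE. Qed.

(** The chain rule for the change of coordinates from [A] to [A']. *)
Lemma d0_transform A A' f x : chart_dom A x -> chart_dom A' x ->
  chart_differentiable A' f x ->
  chart_differentiable A f x /\ d0 f A x =
    d0 f A' x *m (Defs.jacobian A A' x)^T.
Proof.
move=> Ax A'x df; pose T v := chart_map A' (chart_inv A v).
have Tx : T (chart_map A x) = chart_map A' x by rewrite /T chart_mapK.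
have dT j : differentiable (fun v => T v 0 j) (chart_map A x).
  have [d _] := @chart_transition _ _ X A A' j 1%N.
  by apply: d; exists x.
have df' : differentiable (fun v => f (chart_inv A' v)) (T (chart_map A x)).
  by rewrite Tx.
have [d E] := partial_comp dT df'.
have nE : \forall v \near chart_map A x,
  f (chart_inv A' (T v)) = f (chart_inv A v).
  apply: (@chart_inv_near _ _ _ A x
    (fun y => f (chart_inv A' (chart_map A' y)) = f y)) => //.
  have := open_near (chart_dom_open A') A'x; apply: filterS => y A'y.
  by rewrite chart_mapK.
split; first exact: near_eq_differentiable nE d.
apply/rowP => i; rewrite d0E /chart_partial -(partial_near_eq _ nE) E mxE.
by apply: eq_bigr => j _; rewrite d0E Tx !mxE.
Qed.

Lemma chart_partial_smooth U f A i : open U -> smooth_on U f ->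
  smooth_on (U `&` chart_dom A) (chart_partial A i f).
Proof.
move=> oU Uf; have oUA : open (U `&` chart_dom A).
  by apply: openI => //; exact: chart_dom_open.
apply: (@smooth_chart _ _ _ _ _ A) => // k.
apply: (@Ck_eq _ _ _ _ (partial i (fun v => f (chart_inv A v)))).
- exact: open_chart_image.
- by move=> v /chart_imageP[_ _ E]; rewrite /chart_partial E.
- have [_ /(_ i)] := Uf A k.+1; apply: Ck_sub => _ [x [[Ux Ax] _] <-].
  exact: chart_image_mem.
Qed.

Lemma is_form1_d0 U f : open U -> smooth_on U f -> is_form1 U (d0 f).
Proof.
move=> oU Uf; split=> [A i|A A' x Ux Ax A'x].
  apply: smooth_eq (chart_partial_smooth A i oU Uf).
    by apply: openI => //; exact: chart_dom_open.
  by move=> x _; rewrite d0E.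
by apply: (d0_transform Ax A'x _).2; exact: smooth_differentiable Uf Ux A'x.
Qed.

(** In coordinates, dd = 0 is the symmetry of the second derivatives. *)
Lemma d1_d0 U f A x : open U -> smooth_on U f -> U x -> chart_dom A x ->
  d1 (d0 f) A x = 0.
Proof.
move=> oU Uf Ux Ax; apply/matrixP => i j; rewrite !mxE.
have E k l : chart_partial A k (fun y => d0 f A y 0 l) x =
    partial k (partial l (fun v => f (chart_inv A v))) (chart_map A x).
  apply: partial_near_eq.
  have := open_near (@open_chart_image _ _ _ A _ oU) (chart_image_mem Ux Ax).
  by apply: filterS => v /chart_imageP[_ _ vE]; rewrite d0E /chart_partial vE.
apply/eqP; rewrite !E subr_eq0; apply/eqP.
apply: (schwarz _ _ (@open_chart_image _ _ _ A _ oU));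
  first exact: chart_image_mem.
exact: Uf.
Qed.

Lemma form1_differentiable U (w : form1 X) A x i : is_form1 U w -> U x ->
  chart_dom A x -> chart_differentiable A (fun y => w A y 0 i) x.
Proof.
move=> [ws _] Ux Ax; apply: (smooth_differentiable (ws A i)) => //.
Qed.

Lemma is_form1_sub U V w : U `<=` V -> is_form1 V w -> is_form1 U w.
Proof.
move=> UV [ws wt]; split=> [A i|A A' x Ux].
  by apply: smooth_sub (ws A i) => x [/UV].
by apply: wt; exact: UV.
Qed.

Lemma is_form1_local U (w : form1 X) :
  (forall x, U x -> exists2 V, V x & is_form1 V w) -> is_form1 U w.
Proof.
move=> UV; split=> [A i|A A' x Ux Ax A'x].
  apply: smooth_local => x [Ux Ax]; have [V Vx [ws _]] := UV x Ux.
  by exists (V `&` chart_dom A).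
by have [V Vx [_ wt]] := UV x Ux; exact: wt.
Qed.

Lemma is_form1_eq U w w' : open U -> eq_form1 U w w' -> is_form1 U w ->
  is_form1 U w'.
Proof.
move=> oU ww' [ws wt]; split=> [A i|A A' x Ux Ax A'x].
  apply: smooth_eq (ws A i); first by apply: openI => //; exact: chart_dom_open.
  by move=> x [Ux Ax]; rewrite ww'.
by rewrite -!ww'//; exact: wt.
Qed.

Lemma is_form1B U w w' : open U -> is_form1 U w -> is_form1 U w' ->
  is_form1 U (sub_form1 w w').
Proof.
move=> oU [ws wt] [w's w't]; split=> [A i|A A' x Ux Ax A'x].
  have oUA : open (U `&` chart_dom A) by apply: openI => //;
    exact: chart_dom_open.
  by apply: smooth_eq (smoothB oUA (ws A i) (w's A i)) => // x _; rewrite !mxE.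
by rewrite /sub_form1 mulmxBl -wt// -w't.
Qed.

Lemma d1_eq U w w' : open U -> eq_form1 U w w' -> eq_form2 U (d1 w) (d1 w').
Proof.
move=> oU ww' A x Ux Ax; apply/matrixP => i j; rewrite !mxE.
have nE k : \forall y \near x, w A y 0 k = w' A y 0 k.
  have := open_near (openI oU (chart_dom_open A)) (conj Ux Ax).
  by apply: filterS => y [Uy Ay]; rewrite ww'.
by rewrite (chart_partial_near_eq _ Ax (nE j)) (chart_partial_near_eq _ Ax (nE
  i)).
Qed.

Lemma d1B U w w' : is_form1 U w -> is_form1 U w' ->
  eq_form2 U (d1 (sub_form1 w w')) (sub_form2 (d1 w) (d1 w')).
Proof.
move=> wf w'f A x Ux Ax; apply/matrixP => i j; rewrite !mxE.
have E k l : chart_partial A k (fun y => sub_form1 w w' A y 0 l) x =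
    chart_partial A k (fun y => w A y 0 l) x - chart_partial A k (fun y =>
      w' A y 0 l) x.
  rewrite -chart_partialB; [|exact: form1_differentiable wf Ux Ax|exact:
    form1_differentiable w'f Ux Ax].
  by congr chart_partial; apply/funext => y; rewrite !mxE.
by rewrite !E; move: (chart_partial _ _ _ _) => a; ring.
Qed.

End Differentials.

(** * Bump functions *)

Section Bump.
Context {R : realType} {n : nat} {X : manifold R n}.

(** The Euclidean distance, and not the maximum norm of row vectors, has a
    smooth square. *)
Definition sqdist (p v : 'rV[R]_n) : R := \sum_j (v 0 j - p 0 j) ^+ 2.

Definition cutoff (s : R) : R :=
  flat_fun 0 (2 - s) * (flat_fun 0 (2 - s) + flat_fun 0 (s - 1))^-1.

Lemma cutoff_den_gt0 (s : R) : 0 < flat_fun 0 (2 - s) + flat_fun 0 (s - 1).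
Proof.
have [s1|s1] := ltP 1 s.
  by rewrite ltr_wpDl ?flat_fun_ge0// flat_fun_gt0// subr_gt0.
by rewrite ltr_pwDl ?flat_fun_ge0// flat_fun_gt0//; lra.
Qed.

Lemma cutoff1 (s : R) : s <= 1 -> cutoff s = 1.
Proof.
move=> s1; have := cutoff_den_gt0 s;
  rewrite /cutoff (@flat_fun_le0 _ _ (s - 1)) ?subr_le0//.
by rewrite addr0 => /gt_eqF/negbT; exact: divff.
Qed.

Lemma cutoff0 (s : R) : 2 <= s -> cutoff s = 0.
Proof. by move=> s2; rewrite /cutoff flat_fun_le0 ?subr_le0// mul0r. Qed.

Lemma Ck_cutoff_sqdist k U p (e : R) : open U ->
  Ck k U (fun v => cutoff (sqdist p v / e)).
Proof.
move=> oU; have qk : Ck k U (fun v => sqdist p v / e).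
  apply: CkM => //; last exact: Ck_cst.
  apply: Ck_sum => // j.
  by apply: CkM => //; apply: CkB => //; (exact: Ck_coord || exact: Ck_cst).
have nk : Ck k U (fun v => flat_fun 0 (2 - sqdist p v / e)).
  by apply: Ck_flat_fun => //; apply: CkB => //; exact: Ck_cst.
apply: CkM => //; apply: Ck_inv => //.
  by move=> v _; rewrite gt_eqF// cutoff_den_gt0.
by apply: CkD => //; apply: Ck_flat_fun => //; apply: CkB => //; exact: Ck_cst.
Qed.

Lemma sqdist_norm (p v : 'rV[R]_n) (e : R) : 0 < e ->
  sqdist p v / e ^+ 2 < 2 -> `|p - v| <= 2 * e.
Proof.
move=> e0; rewrite ltr_pdivrMr ?exprn_gt0// => q2.
apply: row_norm_le => [|j]; first by rewrite mulr_ge0// ltW.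
rewrite -(@ler_pXn2r _ 2) ?nnegrE ?mulr_ge0 ?(ltW e0)// real_normK ?num_real//.
rewrite exprMn !mxE -sqrrN opprB; apply: (@le_trans _ _ (sqdist p v)).
  by rewrite /sqdist (bigD1 j)//= lerDl sumr_ge0// => i _; exact: sqr_ge0.
by rewrite (le_trans (ltW q2))// ler_wpM2r ?sqr_ge0//; lra.
Qed.

(** A function of the distance in a chart, cut off within a closed ball. The
    set [C] that corresponds to the ball is compact, and so closed in the
    Hausdorff space [X]; hence the extension by zero is smooth everywhere. *)
Lemma bump (U : set X) (x : X) : open U -> U x ->
  exists (psi : X -> R) (C : set X), [/\ smooth_on setT psi, closed C, C `<=` U,
    forall y, ~ C y -> psi y = 0 & \forall y \near x, psi y = 1].
Proof.
move=> oU Ux; have [A Ax] := chart_exists x; set p := chart_map A x.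
have /nbhs_ballP[r /= r0 rU] : nbhs p (chart_image A U).
  by apply: open_nbhs_nbhs; split;
    [exact: open_chart_image|exact: chart_image_mem].
(* The cutoff is 1 up to Euclidean distance e and 0 from distance sqrt 2 * e on,
   hence outside the closed ball of radius 2 e for the maximum norm. *)
pose e := r / 4; have e0 : 0 < e by rewrite divr_gt0.
have e2r : 2 * e < r by rewrite /e; lra.
pose K := closed_ball p (2 * e).
have e20 : 0 < 2 * e by rewrite mulr_gt0.
have KE : K = [set v | `|p - v| <= 2 * e] by rewrite /K closed_ballE.
have KU : K `<=` chart_image A U.
  move=> v; rewrite KE /= => pv; apply: rU; rewrite -ball_normE.
  exact: le_lt_trans e2r.
pose C := chart_inv A @` K.
have cC : closed C.
  apply: compact_closed; first exact: (@manifold_hausdorff _ _ X).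
  apply: continuous_compact; last exact: row_closed_ball_compact.
  apply: continuous_in_subspaceT => v; rewrite inE => /KU[y [_ Ay] <-].
  by apply: chart_inv_continuous; exists y.
have CU : C `<=` U by move=> _ [v /KU/chart_imageP[Uv _ _] <-].
pose b y := cutoff (sqdist p (chart_map A y) / e ^+ 2).
pose psi y : R := if `[< chart_dom A y >] then b y else 0.
have psi0 y : ~ C y -> psi y = 0.
  move=> Cy; rewrite /psi; case: asboolP => // Ay.
  apply: cutoff0; rewrite leNgt; apply/negP => /(sqdist_norm e0) py.
  by apply: Cy; exists (chart_map A y); rewrite ?KE ?chart_mapK.
exists psi, C; split => //.
  apply: smooth_local => y _; have [Ay|Ay] := pselect (chart_dom A y).
    exists (chart_dom A) => //; apply: (@smooth_chart _ _ _ _ _ A) => //.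
      exact: chart_dom_open.
    have oA : open (chart_image A (chart_dom A)) by
      exact/open_chart_image/chart_dom_open.
    move=> k; apply: Ck_eq (Ck_cutoff_sqdist k p (e ^+ 2) oA) => //.
    by move=> v /chart_imageP[Av _ vE]; rewrite /psi asboolT// /b vE.
  have nC : ~ C y.
    by move=> [v /KU/chart_imageP[_ Av _] vy]; apply: Ay; rewrite -vy.
  have oC : open (~` C) by rewrite openC.
  exists (~` C) => //; apply: smooth_eq (smooth_cst 0 oC) => // z Cz.
  by rewrite psi0.
have q1 : \forall v \near p, sqdist p v / e ^+ 2 < 1.
  have qc : Ck 0 setT (fun v => sqdist p v / e ^+ 2).
    have oT : open [set: 'rV[R]_n] by exact: openT.
    apply: CkM => //; last exact: Ck_cst.
    apply: Ck_sum => // j.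
    by apply: CkM => //; apply: CkB => //; (exact: Ck_coord || exact: Ck_cst).
  apply: (qc p I [set s : R | s < 1]).
  apply: open_nbhs_nbhs; split; first exact: open_lt.
  rewrite /= /sqdist big1 ?mul0r ?ltr01// => j _.
  by rewrite subrr expr0n.
have := chart_map_near Ax q1; apply: filterS2 (open_near (chart_dom_open A) Ax).
by move=> y Ay q; rewrite /psi asboolT// /b cutoff1// ltW.
Qed.

End Bump.

(** * Countable bases and refinements of covers *)

Section Refinement.
Context {R : realType} {n : nat} (X : manifold R n).

Lemma countable_basis : exists e : nat -> set X, (forall m, open (e m)) /\
  forall (x : X) (V : set X), nbhs x V -> exists2 m, e m x & e m `<=` V.
Proof.
have [B cB [oB bB]] := @manifold_second_countable _ _ X.
have [f finj] : exists f : set X -> nat, {in B &, injective f}.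
  exact/countable_injP.
exists (fun m => \bigcup_(b in [set b | B b /\ f b = m]) b); split.
  by move=> m; apply: bigcup_open => b [Bb _]; exact: oB.
move=> x V /(bB x)[b [Bb bx] bV]; exists (f b); first by exists b.
by move=> y [b' [Bb' fb'] b'y]; apply: bV; rewrite -(finj b' b) ?inE.
Qed.

(** A new index is a pair of an old one and the number of a basic open set.
    Points of [X] cannot serve as indices: the index types of covers belong to
    a smaller universe than the points. *)
Lemma small_refinement (W : open_cover X) (P : cov_idx W -> set X -> Prop) :
  (forall a V V', V' `<=` V -> P a V -> P a V') ->
  (forall a x, W a x -> exists2 V, nbhs x V & P a V) ->
  exists (W' : open_cover X) (rho : cov_idx W' -> cov_idx W),
    refines rho /\ forall t, P (rho t) (W' t).
Proof.
move=> Psub Ploc; have [e [oe eB]] := countable_basis.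
pose I := {t : cov_idx W * nat | e t.2 `<=` W t.1 /\ P t.1 (e t.2)}.
have cov : \bigcup_(t : I) e (sval t).2 = setT.
  apply/seteqP; split => // x _.
  have [a _ Wx] : (\bigcup_a W a) x by rewrite cov_cover.
  have [V xV PV] := Ploc a x Wx.
  have [m mx mV] : exists2 m, e m x & e m `<=` V `&` W a.
    by apply: eB; apply: filterI => //; exact: open_near (@cov_open _ W a) Wx.
  have mW : e m `<=` W a by move=> y /mV[].
  have PmV : P a (e m) by apply: Psub PV => y /mV[].
  by exists (exist _ (a, m) (conj mW PmV)).
exists (@OpenCover X I (fun t => e (sval t).2) (fun t => oe _) cov).
exists (fun t => (sval t).1).
by split=> [t|t]; [exact: (svalP t).1|exact: (svalP t).2].
Qed.

End Refinement.

(** * Partitions of unity *)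

Section Partition.
Context {R : realType} {n : nat} {X : manifold R n} (U : open_cover X).

(** Lindelof's argument: a bump function is chosen for every basic open set on
    which one with the required properties is constantly 1, and the zero
    function for the others. The default index [i0] goes with the zero
    functions. *)
Lemma countable_bumps (i0 : cov_idx U) :
  exists (psi : nat -> X -> R) (C : nat -> set X) (al : nat -> cov_idx U),
  (forall m, [/\ smooth_on setT (psi m), closed (C m), C m `<=` U (al m) &
      forall y, ~ C m y -> psi m y = 0]) /\
  (forall x : X, exists m, \forall y \near x, psi m y = 1).
Proof.
have [e [oe eB]] := countable_basis X.
pose good (t : (X -> R) * set X * cov_idx U) :=
  [/\ smooth_on setT t.1.1, closed t.1.2, t.1.2 `<=` U t.2 &
      forall y, ~ t.1.2 y -> t.1.1 y = 0].
pose one m t := good t /\ forall y, e m y -> t.1.1 y = 1.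
have datum m : exists t, good t /\ ((exists t, one m t) -> one m t).
  have [[t [gt t1]]|nt] := pselect (exists t, one m t); first by exists t.
  exists (fun=> 0, set0, i0); split=> //.
  by split=> //=; [exact/smooth_cst/openT|exact: closed0].
have [t tP] := choice datum.
exists (fun m => (t m).1.1), (fun m => (t m).1.2), (fun m => (t m).2); split.
  by move=> m; have [] := tP m.
move=> x; have [i _ Uix] : (\bigcup_i U i) x by rewrite cov_cover.
have [psi [C [s cC CU C0 n1]]] := bump (@cov_open _ U i) Uix.
have [m mx m1] := eB x _ n1.
exists m; have [_] := tP m; case; first by exists (psi, C, i); split.
by move=> _ h; have := open_near (oe m) mx; exact: filterS.
Qed.

(** The sheaf of smooth functions is acyclic in degree one. If every point has
    a neighbourhood on which one of the bump functions psi_m is 1, the products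
    phi_m = psi_m (1 - psi_0) ... (1 - psi_(m-1)) form a partition of unity. It
    is locally finite without any appeal to paracompactness, since all phi_m with
    m > M vanish where psi_M = 1. With the support of phi_m contained in the
    member al m of the cover, g_i is the sum of the phi_m k_(i, al m). *)
Lemma smooth_coboundary (k : cov_idx U -> cov_idx U -> X -> R) :
  (forall i j, smooth_on (U i `&` U j) (k i j)) ->
  (forall i j l x, (U i `&` U j `&` U l) x -> k i j x + k j l x = k i l x) ->
  exists g : cov_idx U -> X -> R, (forall i, smooth_on (U i) (g i)) /\
    forall i j x, (U i `&` U j) x -> k i j x = g i x - g j x.
Proof.
move=> ks kC; have [[x0]|nX] := pselect (exists x : X, True); last first.
  exists (fun _ _ => 0); split => [i|i j x]; last by exfalso; apply: nX;
    exists x.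
  by apply: smooth_cst; exact: cov_open.
have [i0 _ _] : (\bigcup_i U i) x0 by rewrite cov_cover.
have [psi [C [al [psiP psi1]]]] := countable_bumps i0.
have psi0 m y : ~ C m y -> psi m y = 0 by have [_ _ _] := psiP m; apply.
pose rest m y := \prod_(l < m) (1 - psi l y).
pose phi m y := psi m y * rest m y.
have sum_phi N y : \sum_(m < N) phi m y = 1 - rest N y.
  elim: N => [|N IH]; first by rewrite /rest !big_ord0 subrr.
  by rewrite big_ord_recr /= IH /rest big_ord_recr /= /phi /rest; ring.
have oT : open [set: X] by exact: openT.
have rest_smooth m : smooth_on setT (rest m).
  elim: m => [|m IH].
    by apply: smooth_eq (smooth_cst 1 oT) => // y _; rewrite /rest big_ord0.
  apply: (@smooth_eq _ _ _ _ (fun y => rest m y * (1 - psi m y))) => //.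
    by move=> y _; rewrite /rest big_ord_recr.
  apply: smoothM => //; apply: smoothB => //; first exact: smooth_cst.
  by have [] := psiP m.
have phi_smooth m : smooth_on setT (phi m).
  by apply: smoothM => //; have [] := psiP m.
have oU i : open (U i) by exact: cov_open.
pose G i N y := \sum_(m < N) phi m y * k i (al m) y.
have term_smooth i m : smooth_on (U i) (fun y => phi m y * k i (al m) y).
  have [_ cC CU _] := psiP m.
  apply: smooth_local => x Ux; have [Cx|Cx] := pselect (C m x).
    exists (U i `&` U (al m)); first by split => //; exact: CU.
    apply: smoothM; [exact: openI|exact: smooth_sub (phi_smooth m)|exact: ks].
  have oC : open (~` C m) by rewrite openC.
  exists (~` C m) => //; apply: smooth_eq (smooth_cst 0 oC) => // y Cy.
  by rewrite /phi psi0// !mul0r.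
have G_smooth i N : smooth_on (U i) (G i N).
  by apply: smooth_sum => // m; exact: term_smooth.
have G_stable i y M N : psi M y = 1 -> (M < N)%N -> G i N y = G i M.+1 y.
  move=> p1; elim: N => // N IH; rewrite ltnS leq_eqVlt => /predU1P[->//|MN].
  rewrite /G big_ord_recr /= -/(G i N y) IH// /phi /rest.
  rewrite (bigD1 (Ordinal MN))//= p1 subrr mul0r mulr0 mul0r addr0.
  by [].
have [M MP] := choice psi1.
(* The number of summands varies from point to point; by [G_stable] it is
   constant near each point. *)
exists (fun i y => G i (M y).+1 y); split.
  move=> i; apply: smooth_local => x Ux.
  have : nbhs x [set y | psi (M x) y = 1] by exact: MP.
  rewrite nbhsE => -[V [oV Vx] V1].
  exists (U i `&` V) => //.
  apply: (@smooth_eq _ _ _ _ (G i (M x).+1)); first exact: openI.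
    move=> y [_ /V1 y1]; have My : psi (M y) y =
      1 by exact: nbhs_singleton (MP y).
    pose N := maxn (M x) (M y).
    rewrite -(@G_stable i y (M x) N.+1) ?ltnS ?leq_maxl//.
    by rewrite -(@G_stable i y (M y) N.+1) ?ltnS ?leq_maxr.
  by apply: smooth_sub (G_smooth i _) => y [].
move=> i j x [Ui Uj]; rewrite /G -sumrB.
have Mx : psi (M x) x = 1 by exact: nbhs_singleton (MP x).
rewrite (eq_bigr (fun m : 'I_(M x).+1 => phi m x * k i j x)); last first.
  move=> m _; rewrite -mulrBr; have [Cx|Cx] := pselect (C m x).
    have [_ _ CU _] := psiP m.
    by rewrite -(kC i j (al m) x) ?addrK//; split => //; exact: CU.
  by rewrite /phi psi0// !mul0r.
rewrite -mulr_suml sum_phi /rest big_ord_recr /= Mx subrr mulr0 subr0.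
by rewrite mul1r.
Qed.

End Partition.

(** * Closed 1-forms and locally constant cochains *)

Section ClosedForms.
Context {R : realType} {n : nat} {X : manifold R n}.
Implicit Types (U V : set X) (f g : X -> R) (A : chart_idx X).

(** The charts may differ from point to point, as vanishing of the
    differential does not depend on the chart. *)
Lemma locally_constant_d0 U f : open U ->
  (forall x, U x -> exists A,
     [/\ chart_dom A x, chart_differentiable A f x & d0 f A x = 0]) ->
  locally_constant U f.
Proof.
move=> oU f0 x Ux; have [A Ax] := chart_exists x.
have dA y : U y -> chart_dom A y -> chart_differentiable A f y /\ d0 f A y = 0.
  move=> Uy Ay; have [A' [A'y df d0f]] := f0 y Uy.
  have [d E] := d0_transform Ay A'y df.
  by split=> //; rewrite E d0f mul0mx.
have /nbhs_ballP[r /= r0 rU] : nbhs (chart_map A x) (chart_image A U).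
  by apply: open_nbhs_nbhs; split;
    [exact: open_chart_image|exact: chart_image_mem].
have cst v : ball (chart_map A x) r v -> f (chart_inv A v) = f x.
  move=> bv; rewrite -[in RHS](chart_mapK Ax).
  apply: (@gradient0_constant _ _ (fun v => f (chart_inv A v))) bv => u /rU.
  move=> /chart_imageP[Uu Au uE]; have [d E] := dA _ Uu Au.
  rewrite /chart_differentiable uE in d; split=> // i.
  by have /rowP/(_ i) := E; rewrite d0E /chart_partial uE mxE.
have rb : \forall v \near chart_map A x,
  ball (chart_map A x) r v by exact: nbhsx_ballx.
have := chart_map_near Ax rb; apply: filterS2 (open_near (chart_dom_open A) Ax).
by move=> y Ay /cst; rewrite chart_mapK.
Qed.

Definition chart_ball A (p : 'rV[R]_n) (r : R) : set X :=
  chart_dom A `&` [set x | ball p r (chart_map A x)].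

Lemma open_chart_ball A p r : open (chart_ball A p r).
Proof.
rewrite openE => x [Ax bx]; rewrite /interior.
have nb : \forall v \near chart_map A x, ball p r v.
  by apply: open_nbhs_nbhs; split => //; exact: ball_open.
apply: filterS2 (open_near (chart_dom_open A) Ax) (chart_map_near Ax nb).
by move=> y.
Qed.

Lemma poincare_chart A p r U (w : form1 X) : ball p r `<=` chart_image A U ->
  is_form1 U w -> eq_form2 U (d1 w) (fun _ _ => 0) ->
  exists g, forall x, chart_ball A p r x ->
    chart_differentiable A g x /\ d0 g A x = w A x.
Proof.
move=> bU [ws _] dw.
have [||g gP] := @poincare R n p r (fun i v => w A (chart_inv A v) 0 i).
- move=> i; apply: Ck_sub (ws A i A 2%N) => v /bU [x [Ux Ax] <-].
  exact: chart_image_mem.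
- move=> i j v /bU/chart_imageP[Uv Av vE].
  have /matrixP/(_ i j) := dw A _ Uv Av; rewrite !mxE => /eqP.
  by rewrite subr_eq0 /chart_partial vE => /eqP.
exists (fun x => g (chart_map A x)) => x [Ax bx].
have [dg pg] := gP _ bx.
have nE : \forall v \near chart_map A x, g v = g (chart_map A (chart_inv A v)).
  have : \forall v \near chart_map A x, ball p r v.
    by apply: open_nbhs_nbhs; split => //; exact: ball_open.
  by apply: filterS => v /bU/chart_imageP[_ _ ->].
split; first exact: near_eq_differentiable nE dg.
apply/rowP => i; rewrite d0E /chart_partial -(partial_near_eq _ nE) pg.
by rewrite chart_mapK.
Qed.

(** On a refinement on which the closed forms [be a] have primitives g_a, the
    functions q_ab = F_ab - g_a + g_b have zero differential, so they are
    locally constant; they have the same coboundary as [F]. *)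
Lemma closed_forms_coboundary (W : open_cover X) (be : cov_idx W -> form1 X)
    (F : cov_idx W -> cov_idx W -> X -> R) :
  (forall a, is_form1 (W a) (be a)) ->
  (forall a, eq_form2 (W a) (d1 (be a)) (fun _ _ => 0)) ->
  (forall a b, smooth_on (W a `&` W b) (F a b)) ->
  (forall a b, eq_form1 (W a `&` W b) (sub_form1 (be a) (be b)) (d0 (F a b))) ->
  (forall a b x, (W a `&` W b) x -> F b a x = - F a b x) ->
  exists (W' : open_cover X) (rho : cov_idx W' -> cov_idx W)
      (q : cov_idx W' -> cov_idx W' -> X -> R),
    [/\ refines rho, forall a b, locally_constant (W' a `&` W' b) (q a b) &
      forall a b d x, (W' a `&` W' b `&` W' d) x ->
        let F' a b := F (rho a) (rho b) x in
        F' a b + F' b d + F' d a + q a d x = q a b x + q b d x].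
Proof.
move=> beF dbe Fs Fd Fanti.
pose prim a (V : set X) (gA : (X -> R) * chart_idx X) := forall x, V x ->
  [/\ chart_dom gA.2 x, chart_differentiable gA.2 gA.1 x &
      d0 gA.1 gA.2 x = be a gA.2 x].
have [||W' [rho [rhoW prims]]] :=
    @small_refinement _ _ X W (fun a V => exists gA, prim a V gA).
- by move=> a V V' VV [gA gAP]; exists gA => x /VV; exact: gAP.
- move=> a x Wx; have [A Ax] := chart_exists x.
  have /nbhs_ballP[r /= r0 rU] : nbhs (chart_map A x) (chart_image A (W a)).
    apply: open_nbhs_nbhs; split; last exact: chart_image_mem.
    exact/open_chart_image/cov_open.
  have [g gP] := poincare_chart rU (beF a) (dbe a).
  exists (chart_ball A (chart_map A x) r).
    apply: open_near; first exact: open_chart_ball.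
    by split => //=; exact: ballxx.
  exists (g, A) => y [Ay yb]; have [] := gP y (conj Ay yb).
  by split.
have [g gP] := choice prims.
exists W', rho, (fun a b x => F (rho a) (rho b) x - (g a).1 x + (g b).1 x).
split=> // [a b|a b d x [[ax bx] dx]]; last first.
  by rewrite /= (Fanti (rho a) (rho d)); [ring|split; exact: rhoW].
have oW t : open (W' t) by exact: cov_open.
apply: locally_constant_d0 => [|x [ax bx]]; first exact: openI.
have Wa := rhoW _ _ ax; have Wb := rhoW _ _ bx.
have [Aa dga gaE] := gP a x ax; have [Ab dgb gbE] := gP b x bx.
set A := (g a).2 in Aa dga gaE; set A' := (g b).2 in Ab dgb gbE.
have [dgb' gbE'] := d0_transform Aa Ab dgb.
have dF : chart_differentiable A (F (rho a) (rho b)) x.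
  exact: smooth_differentiable (Fs _ _) (conj Wa Wb) Aa.
have gbA : d0 (g b).1 A x = be (rho b) A x.
  by rewrite gbE' gbE; have [_ <-] := beF (rho b).
exists A; split => //.
  by apply: differentiableD => //; exact: differentiableB.
apply/rowP => i; rewrite d0E chart_partialD//; last exact: differentiableB.
rewrite chart_partialB// -!d0E gbA gaE.
have := Fd (rho a) (rho b) A x (conj Wa Wb) Aa.
move=> /rowP/(_ i) <-; rewrite !mxE.
by move: (be (rho a) A x 0 i) (be (rho b) A x 0 i) => u v; ring.
Qed.

End ClosedForms.

(** * Metrics and holonomy forms on a line bundle *)

Section LineBundleFacts.
Context {R : realType} {n : nat} {X : manifold R n}.

Lemma scalar_funZ (V : lmodType R) (f : V -> R) : scalar f ->
  forall t a, f (t *: a) = t * f a.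
Proof.
move=> lf t a; have f0 : f 0 = 0.
  by have /eqP := lf 1 0 0; rewrite scaler0 addr0 mul1r -subr_eq subrr => /eqP.
by have := lf t a 0; rewrite f0 !addr0.
Qed.

Variables (U : set X) (l : line_bundle U).

Lemma lb_dom_sub (m : lb_idx l) : lb_dom m `<=` U.
Proof. by move=> x mx; rewrite -(lb_dom_cover l); exists m. Qed.

Lemma lb_dom_exists x : U x -> exists m : lb_idx l, lb_dom m x.
Proof. by rewrite -{1}(lb_dom_cover l) => -[m _ mx]; exists m. Qed.

Lemma line_span x (a v : l x) : U x -> a != 0 -> exists t, v = t *: a.
Proof.
move=> Ux a0; have [m mx] := lb_dom_exists Ux.
have [e0 eP] := lb_frame_basis mx; have [s aE] := eP a; have [t vE] := eP v.
have s0 : s != 0 by apply: contra_neq a0 => s0; rewrite aE s0 scale0r.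
by exists (t / s); rewrite aE scalerA divfK.
Qed.

Lemma frame_neq0 (m : lb_idx l) x : lb_dom m x -> lb_frame m x != 0.
Proof. by move=> /lb_frame_basis[]. Qed.

Lemma local_frame_lb_frame (W : set X) (m : lb_idx l) : W `<=` lb_dom m ->
  local_frame W (lb_frame m).
Proof.
move=> Wm; split=> [x /Wm|m']; first exact: frame_neq0.
have [g gs gE] := lb_transition m m'; exists g.
  by apply: smooth_sub gs => x [/Wm].
by move=> x [/Wm mx m'x]; exact: gE.
Qed.

Section Metrics.
Variable h : metric l.

Lemma metricZ x (a : l x) t : U x -> h x (t *: a) (t *: a) = t ^+ 2 * h x a a.
Proof.
move=> Ux; have hl := met_linear h Ux.
rewrite (scalar_funZ (hl _)) (met_sym h Ux) (scalar_funZ (hl _)).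
by rewrite expr2 mulrA.
Qed.

Lemma metric_frame_gt0 (m : lb_idx l) x : lb_dom m x ->
  0 < h x (lb_frame m x) (lb_frame m x).
Proof.
by move=> mx; apply: met_pos; [exact: lb_dom_sub mx|exact: frame_neq0].
Qed.

Lemma smooth_metric (W : set X) (s : forall x, l x) : open W -> W `<=` U ->
  local_frame W s -> smooth_on W (fun x => h x (s x) (s x)).
Proof.
move=> oW WU [s0 sf]; apply: smooth_local => x Wx.
have [m mx] := lb_dom_exists (WU x Wx).
have oWm : open (W `&` lb_dom m) by apply: openI => //; exact: lb_dom_open.
exists (W `&` lb_dom m) => //; have [f fs fE] := sf m.
apply: (@smooth_eq _ _ _ _ (fun y =>
  f y * f y * h y (lb_frame m y) (lb_frame m y))) => //.
  by move=> y Wmy; rewrite fE// metricZ ?expr2//; apply: WU; case: Wmy.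
apply: smoothM => //; first exact: smoothM.
by apply: smooth_sub (met_smooth h m) => y [].
Qed.

(** In a frame e, the form of the metric connection is (1/2) d ln h(e, e). *)
Lemma theta_frame (D : connection l) (w : form1 X) : is_theta D h w ->
  forall (m : lb_idx l) A x i, lb_dom m x -> chart_dom A x ->
  w A x 0 i = D m A x 0 i -
    2^-1 * chart_partial A i (fun y =>
      ln (h y (lb_frame m y) (lb_frame m y))) x.
Proof.
move=> [Dh Dhc wE] m A x i mx Ax; rewrite (wE m)// !mxE; congr (_ - _).
have h0 := metric_frame_gt0 mx.
rewrite chart_partial_ln//; last first.
  exact: smooth_differentiable (met_smooth h m) mx Ax.
have /rowP/(_ i) := Dhc m A x mx Ax; rewrite !mxE => ->.
by field; rewrite gt_eqF.
Qed.

End Metrics.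

(** A nonzero vector at every point, without any continuity in [x]. It serves
    to evaluate expressions that are the same for all nonzero vectors. *)
Definition some_vector x : l x :=
  if pselect (exists a : l x, a != 0) is left a0 then sval (cid a0) else 0.

Lemma some_vector_neq0 x : U x -> some_vector x != 0.
Proof.
move=> Ux; rewrite /some_vector; case: pselect => [a0|na].
  exact: (svalP (cid a0)).
by have [m /frame_neq0 e0] := lb_dom_exists Ux; case: na; exists (lb_frame m x).
Qed.

(** By [log_ratioE] the vector does not matter, hence the function is smooth
    even though [some_vector] is an arbitrary choice. *)
Definition log_ratio (h h' : metric l) x : R :=
  ln (h' x (some_vector x) (some_vector x)) -
  ln (h x (some_vector x) (some_vector x)).

Lemma log_ratioE h h' x (a : l x) : U x -> a != 0 ->
  log_ratio h h' x = ln (h' x a a) - ln (h x a a).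
Proof.
move=> Ux a0; have [t E] := line_span (some_vector x) Ux a0.
have t0 : t != 0.
  by have := some_vector_neq0 Ux; rewrite E; apply: contra_neq => ->;
    rewrite scale0r.
have lnh (h0 : metric l) : ln (t ^+ 2 * h0 x a a) = ln (t ^+ 2) + ln (h0 x a a).
  by rewrite lnM ?posrE ?met_pos// exprn_even_gt0.
rewrite /log_ratio E !metricZ// !lnh.
by move: (ln (t ^+ 2)) => u; ring.
Qed.

Lemma smooth_log_ratio h h' : open U -> smooth_on U (log_ratio h h').
Proof.
move=> oU; apply: smooth_local => x Ux; have [m mx] := lb_dom_exists Ux.
have om : open (lb_dom m) by exact: lb_dom_open.
exists (lb_dom m) => //.
apply: (@smooth_eq _ _ _ _ (fun y => ln (h' y (lb_frame m y) (lb_frame m y)) -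
   ln (h y (lb_frame m y) (lb_frame m y)))) => //.
  move=> y my; rewrite -log_ratioE//; [exact: lb_dom_sub my|exact: frame_neq0].
apply: smoothB => //; apply: smooth_ln => //; try exact: met_smooth.
  by move=> y; exact: metric_frame_gt0.
by move=> y; exact: metric_frame_gt0.
Qed.

(** The connection forms cancel in the difference of the two holonomy forms. *)
Lemma theta_diff (h h' : metric l) (D : connection l) w w' : open U ->
  is_theta D h w -> is_theta D h' w' ->
  eq_form1 U (sub_form1 w w') (d0 (fun x => 2^-1 * log_ratio h h' x)).
Proof.
move=> oU th th' A x Ux Ax; have [m mx] := lb_dom_exists Ux.
have om : open (lb_dom m) by exact: lb_dom_open.
pose lg (h : metric l) y := ln (h y (lb_frame m y) (lb_frame m y)).
apply/rowP => i; rewrite d0E !mxE (theta_frame th i mx Ax) (theta_frame th' i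
  mx Ax).
rewrite -/(lg h) -/(lg h').
have slg (h0 : metric l) : smooth_on (lb_dom m) (lg h0).
  by apply: smooth_ln => // [y|]; [exact: metric_frame_gt0|exact: met_smooth].
rewrite (@chart_partial_near_eq _ _ _ _ _ (fun y => 2^-1 * log_ratio h h' y)
  (fun y => 2^-1 * (lg h' y - lg h y)))//; last first.
  have := open_near om mx; apply: filterS => y my.
  have y0 : lb_frame m y != 0 by exact: frame_neq0.
  by rewrite (log_ratioE h h' (lb_dom_sub my) y0).
have dlg h0 := smooth_differentiable (slg h0) mx Ax.
have dC : chart_differentiable A (fun _ : X => 2^-1 : R) x.
  exact: differentiable_cst.
have dB : chart_differentiable A (fun y => lg h' y - lg h y) x.
  exact: differentiableB (dlg h') (dlg h).
rewrite (chart_partialM _ Ax dC dB) (chart_partialB _ (dlg h') (dlg h)).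
rewrite [chart_partial A i (fun _ => 2^-1) x]partial_cst.
move: (chart_partial _ _ (lg h) _) (chart_partial _ _ (lg h') _) => u v; ring.
Qed.

End LineBundleFacts.

(** * Independence of the metric and of the adaptation *)

Section Independence.
Context {R : realType} {n : nat} {X : manifold R n} (G : gerbe X).
Let U := gb_cover G.

Lemma triple_sub (T : Type) (P Q S : set T) x : (P `&` Q `&` S) x ->
  [/\ (P `&` Q) x, (Q `&` S) x, (S `&` P) x & (P `&` S) x].
Proof. by move=> [[Px Qx] Sx]; split. Qed.

(** The given isomorphisms of the tensor products of lines with the trivial
    bundle are isometries for both metrics, so the logarithms of the ratios
    add up to zero; here for two factors, below for three. *)
Lemma log_ratio_pair (h h' : gerbe_metric G) i j x : (U i `&` U j) x ->
  log_ratio (h j i) (h' j i) x = - log_ratio (h i j) (h' i j) x.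
Proof.
move=> Ux; have Ux' : (U j `&` U i) x by case: Ux.
pose a := some_vector (@gb_line _ _ _ G i j) x;
  pose b := some_vector (@gb_line _ _ _ G j i) x.
have a0 : a != 0 by exact: some_vector_neq0.
have b0 : b != 0 by exact: some_vector_neq0.
rewrite (log_ratioE _ _ Ux' b0) (log_ratioE _ _ Ux a0).
have E : h i j x a a * h j i x b b = h' i j x a a * h' j i x b b.
  by rewrite -!gm_pair.
have := congr1 (@ln R) E; rewrite !lnM ?posrE; try exact: met_pos.
by move=> /eqP; lra.
Qed.

Lemma log_ratio_triple (h h' : gerbe_metric G) i j k x :
  (U i `&` U j `&` U k) x ->
  log_ratio (h i j) (h' i j) x + log_ratio (h j k) (h' j k) x =
  log_ratio (h i k) (h' i k) x.
Proof.
move=> Ux; have [ij jk ki ik] := triple_sub Ux.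
rewrite -[RHS]opprK -log_ratio_pair//.
pose a := some_vector (@gb_line _ _ _ G i j) x;
  pose b := some_vector (@gb_line _ _ _ G j k) x.
pose c := some_vector (@gb_line _ _ _ G k i) x.
have a0 : a != 0 by exact: some_vector_neq0.
have b0 : b != 0 by exact: some_vector_neq0.
have c0 : c != 0 by exact: some_vector_neq0.
rewrite (log_ratioE _ _ ij a0) (log_ratioE _ _ jk b0) (log_ratioE _ _ ki c0).
have E : h i j x a a * h j k x b b * h k i x c c =
    h' i j x a a * h' j k x b b * h' k i x c c.
  by rewrite -!gm_triv.
have p (h0 : gerbe_metric G) : [/\ 0 < h0 i j x a a,
  0 < h0 j k x b b & 0 < h0 k i x c c].
  by split; exact: met_pos.
have [h1 h2 h3] := p h; have [h1' h2' h3'] := p h'.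
have := congr1 (@ln R) E; rewrite !lnM ?posrE ?mulr_gt0//.
by move=> /eqP; lra.
Qed.

(** Half the logarithms of the ratios of the metrics are a smooth 1-cocycle,
    so they are differences g_i - g_j. The forms be_i - be'_i - dg_i agree on
    the overlaps by [theta_diff], and the form that they define is a primitive
    of B - B'. *)
Lemma holonomy_form_independent (D : gerbe_connection G) (h h' : gerbe_metric G)
    (be be' : cov_idx U -> form1 X) (B B' : form2 X) :
  holonomy_form D h be B -> holonomy_form D h' be' B' ->
  de_rham_cohomologous B B'.
Proof.
move=> [[bf bth] _ Bd] [[bf' bth'] _ Bd'].
have oU i : open (U i) by exact: cov_open.
have oUU i j : open (U i `&` U j) by exact: openI.
pose k i j x := 2^-1 * log_ratio (h i j) (h' i j) x.
have ks i j : smooth_on (U i `&` U j) (k i j).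
  by apply: smoothM => //; [exact: smooth_cst|exact: smooth_log_ratio].
have kC i j l x : (U i `&` U j `&` U l) x -> k i j x + k j l x = k i l x.
  by move=> Ux; rewrite /k -mulrDr log_ratio_triple.
have [g [gs gE]] := smooth_coboundary ks kC.
pose w i := sub_form1 (sub_form1 (be i) (be' i)) (d0 (g i)).
have bb i : is_form1 (U i) (sub_form1 (be i) (be' i)) by exact: is_form1B.
have dg i : is_form1 (U i) (d0 (g i)) by exact: is_form1_d0.
have wf i : is_form1 (U i) (w i) by exact: is_form1B.
have wE i j A x : U i x -> U j x -> chart_dom A x -> w i A x = w j A x.
  move=> Ui Uj Ax; have Uij : (U i `&` U j) x by [].
  have := theta_diff (oUU i j) (bth i j) (bth' i j) Uij Ax.
  rewrite -/(k i j) => E; apply/rowP => l; have /rowP/(_ l) := E.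
  rewrite !mxE (@chart_partial_near_eq _ _ _ _ _ (k i j) (fun y =>
    g i y - g j y))//; last first.
    have := open_near (oUU i j) Uij; apply: filterS => y; exact: gE.
  rewrite chart_partialB; last 2 first.
  - exact: smooth_differentiable (gs i) Ui Ax.
  - exact: smooth_differentiable (gs j) Uj Ax.
  by move=> /eqP; lra.
have ex x : exists i, U i x.
  have : (\bigcup_i U i) x by rewrite cov_cover.
  by case=> i _ Ux; exists i.
have [iota iotaP] := choice ex.
pose w0 : form1 X := fun A x => w (iota x) A x.
have w0E i : eq_form1 (U i) (w i) w0.
  by move=> A x Ui Ax; exact: wE.
exists w0.
  apply: is_form1_local => x _; exists (U (iota x)) => //.
  exact: is_form1_eq (w0E _) (wf _).
move=> A x _ Ax; have Ux := iotaP x; set i := iota x in Ux.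
rewrite -(d1_eq (oU i) (w0E i) Ux Ax) (d1B (bb i) (dg i) Ux Ax) /sub_form2.
rewrite (d1_d0 (oU i) (gs i) Ux Ax) subr0 (d1B (bf i) (bf' i) Ux Ax) /sub_form2.
by rewrite -Bd// -Bd'.
Qed.

End Independence.

(** * Cech cocycles with constant coefficients *)

Section CechFacts.
Context {R : realType} {n : nat} {X : manifold R n}.

Lemma locally_constant_comp2 (op : R -> R -> R) U (f g : X -> R) :
  locally_constant U f -> locally_constant U g ->
  locally_constant U (fun x => op (f x) (g x)).
Proof.
by move=> fc gc x Ux; apply: filterS2 (fc x Ux) (gc x Ux) => y -> ->.
Qed.

Lemma locally_constant_comp (op : R -> R) U (f : X -> R) :
  locally_constant U f -> locally_constant U (fun x => op (f x)).
Proof. by move=> fc x Ux; apply: filterS (fc x Ux) => y ->. Qed.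

Lemma locally_constant_sub U V (f : X -> R) : U `<=` V ->
  locally_constant V f -> locally_constant U f.
Proof. by move=> UV fc x /UV; exact: fc. Qed.

Lemma cover_meet_cover (V W : open_cover X) :
  \bigcup_(ab : cov_idx V * cov_idx W) (V ab.1 `&` W ab.2) = setT.
Proof.
apply/seteqP; split=> // x _.
have [a _ Va] : (\bigcup_a V a) x by rewrite cov_cover.
have [b _ Wb] : (\bigcup_b W b) x by rewrite cov_cover.
by exists (a, b).
Qed.

Definition cover_meet (V W : open_cover X) : open_cover X :=
  OpenCover (fun ab : cov_idx V * cov_idx W =>
    openI (@cov_open _ V ab.1) (@cov_open _ W ab.2)) (cover_meet_cover V W).

Lemma is_cocycle_lnabs c : is_cocycle (coef_Rstar X) c ->
  is_cocycle (coef_R X) (map_cochain (fun t => ln `|t|) c).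
Proof.
move=> [cs cc]; split=> [i j k|i j k l x];
  first exact/locally_constant_comp/(cs i j k).1.
move=> [[[Vi Vj] Vk] Vl] /=.
have nz a b d (Vx : (c2_cover c a `&` c2_cover c b `&` c2_cover c d) x) :
    `|c a b d x| \is Num.pos.
  by rewrite posrE normr_gt0; exact: (cs a b d).2.
by rewrite -!lnM ?nz// -!normrM; congr (ln `|_|); exact: cc.
Qed.

(** The difference of two sets of de Rham data for the same 2-form consists of
    closed 1-forms and of functions with coboundary y2 - y1, as in
    [closed_forms_coboundary]. *)
Lemma cech_de_rham_cohomologous (B : form2 X) (y1 y2 y : cochain2 X) :
  cech_de_rham B y1 -> cech_de_rham B y2 ->
  cohomologous (coef_R X) y2 y -> cohomologous (coef_R X) y1 y.
Proof.
move=> [be1 [f1 [be1F f1s f1N f1d y1E]]] [be2 [f2 [be2F f2s f2N f2d y2E]]].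
move=> [W0 [rho2 [rho [q0 [r2 r q0s q0E]]]]].
pose W := cover_meet W0 (c2_cover y1).
pose p2 (a : cov_idx W) := rho2 a.1; pose p1 (a : cov_idx W) := a.2.
have s2 a : W a `<=` c2_cover y2 (p2 a) by move=> x [/r2].
have s1 a : W a `<=` c2_cover y1 (p1 a) by move=> x [].
have oW a : open (W a) by exact: cov_open.
have oWW a b : open (W a `&` W b) by exact: openI.
have b1 a : is_form1 (W a) (be1 (p1 a)).
  by apply: is_form1_sub (be1F (p1 a)).1; exact: s1.
have b2 a : is_form1 (W a) (be2 (p2 a)).
  by apply: is_form1_sub (be2F (p2 a)).1; exact: s2.
pose be a := sub_form1 (be2 (p2 a)) (be1 (p1 a)).
pose F a b x := f2 (p2 a) (p2 b) x - f1 (p1 a) (p1 b) x.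
have F2 a b : smooth_on (W a `&` W b) (f2 (p2 a) (p2 b)).
  by apply: smooth_sub (f2s _ _) => x [/s2 ? /s2].
have F1 a b : smooth_on (W a `&` W b) (f1 (p1 a) (p1 b)).
  by apply: smooth_sub (f1s _ _) => x [/s1 ? /s1].
have [||||| W' [kap [q1 [kr q1s q1E]]]] := @closed_forms_coboundary _ _ _ W be
  F.
- by move=> a; exact: is_form1B.
- move=> a A x Wx Ax; rewrite (d1B (b2 a) (b1 a) Wx Ax) /sub_form2.
  rewrite -(be2F (p2 a)).2//; last exact: s2.
  by rewrite -(be1F (p1 a)).2 ?subrr//; exact: s1.
- by move=> a b; exact: smoothB.
- move=> a b A x Wx Ax; have [Wa Wb] := Wx; apply/rowP => i.
  rewrite d0E chart_partialB; last 2 first.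
  + exact: smooth_differentiable (F2 a b) Wx Ax.
  + exact: smooth_differentiable (F1 a b) Wx Ax.
  have /rowP/(_ i) := f2d (p2 a) (p2 b) A x (conj (s2 _ _ Wa) (s2 _ _ Wb)) Ax.
  have /rowP/(_ i) := f1d (p1 a) (p1 b) A x (conj (s1 _ _ Wa) (s1 _ _ Wb)) Ax.
  by rewrite !d0E => <- <-; rewrite !mxE; ring.
- move=> a b x [Wa Wb]; rewrite /F (f2N (p2 a)) ?(f1N (p1 a)) ?opprB//.
  + by rewrite opprK addrC.
  + by split; exact: s1.
  + by split; exact: s2.
exists W', (fun a => p1 (kap a)), (fun a => rho (kap a).1).
exists (fun a b x => q0 (kap a).1 (kap b).1 x + q1 a b x); split.
- by move=> a x /kr/s1.
- by move=> a x /kr[/r].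
- move=> a b; apply: locally_constant_comp2 (q1s a b).
  by apply: locally_constant_sub (q0s _ _) => x [/kr[? _] /kr[]].
- move=> a b d x Wabd; have := q1E a b d x Wabd.
  have [[/kr Wa /kr Wb] /kr Wd] := Wabd.
  have := q0E (kap a).1 (kap b).1 (kap d).1 x; rewrite /=.
  have [Wa0 _] := Wa; have [Wb0 _] := Wb; have [Wd0 _] := Wd.
  move=> /(_ (conj (conj Wa0 Wb0) Wd0)).
  rewrite (y2E (p2 (kap a)) (p2 (kap b)) (p2 (kap d))); last first.
    by split; [split|]; exact: s2.
  rewrite (y1E (p1 (kap a)) (p1 (kap b)) (p1 (kap d))); last first.
    by split; [split|]; exact: s1.
  rewrite /F => /eqP E1 /eqP; move: E1; lra.
Qed.

End CechFacts.

(** * Holonomy forms in flat frames *)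

Section FlatFrames.
Context {R : realType} {n : nat} {X : manifold R n}.
Variables (U : set X) (l : line_bundle U).

(** Minus the logarithm of the norm of [s]. *)
Definition log_norm (h : metric l) (s : forall x, l x) x : R :=
  - (2^-1 * ln (h x (s x) (s x))).

Lemma local_frame_sub (V W : set X) (s : forall x, l x) : V `<=` W ->
  local_frame W s -> local_frame V s.
Proof.
move=> VW [s0 sf]; split=> [x /VW|m]; first exact: s0.
have [f fs fE] := sf m; exists f; first by apply: smooth_sub fs => x [/VW].
by move=> x [/VW Wx mx]; exact: fE.
Qed.

Lemma smooth_log_norm (h : metric l) (W : set X) s : open W -> W `<=` U ->
  local_frame W s -> smooth_on W (log_norm h s).
Proof.
move=> oW WU ls; apply: smoothN => //; apply: smoothM => //;
  first exact: smooth_cst.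
apply: smooth_ln => //; last exact: smooth_metric.
by move=> x Wx; apply: met_pos; [exact: WU|exact: ls.1].
Qed.

(** In the flat frame [s] the connection form is zero, so only the term -
    (1/2) d ln h(s, s) of the holonomy form remains. As connections are given
    by their forms in the frames e_m, the computation takes place there: s = f
    e_m is flat if and only if df = - f a, where a is the connection form. *)
Lemma flat_frame_theta (D : connection l) (h : metric l) (w : form1 X)
    (W : set X) (s : forall x, l x) : open W -> W `<=` U ->
  local_frame W s -> flat_section D W s -> is_theta D h w ->
  eq_form1 W w (d0 (log_norm h s)).
Proof.
move=> oW WU ls fl th A x Wx Ax; have [m mx] := lb_dom_exists l (WU x Wx).
have [s0 /(_ m)[f fs fE]] := ls.
have oWm : open (W `&` lb_dom m) by apply: openI => //; exact: lb_dom_open.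
have Wmx : (W `&` lb_dom m) x by [].
pose hm y := h y (lb_frame m y) (lb_frame m y).
have hms : smooth_on (lb_dom m) hm by exact: met_smooth.
have f0 : f x != 0.
  by have := s0 x Wx; rewrite fE//; apply: contra_neq => ->; rewrite scale0r.
have q0 : 0 < hm x by exact: metric_frame_gt0.
have df := smooth_differentiable fs Wmx Ax.
have dh := smooth_differentiable hms mx Ax.
have dff : chart_differentiable A (fun y =>
  f y * f y) x by exact: differentiableM.
have dH : chart_differentiable A (fun y =>
  f y * f y * hm y) x by exact: differentiableM.
have dL : chart_differentiable A (fun y => ln (f y * f y * hm y)) x.
  have sL : smooth_on (lb_dom m `&` W) (log_norm h s).
    by apply: smooth_sub (smooth_log_norm h oW WU ls) => y [].
  apply: (@chart_differentiable_near_eq _ _ _ _ (fun y =>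
    - 2 * log_norm h s y)) => //.
    have := open_near oWm Wmx; apply: filterS => y [Wy my].
    rewrite /log_norm fE//  metricZ; last exact: lb_dom_sub my.
    by rewrite expr2; field.
  apply: differentiableM; first exact: differentiable_cst.
  exact: (smooth_differentiable sL (conj mx Wx) Ax).
apply/rowP => i; rewrite (theta_frame th i mx Ax) -/hm d0E.
have flE := fl m f fs fE A x Wmx Ax; have /rowP/(_ i) := flE;
  rewrite !mxE => dE.
rewrite (@chart_partial_near_eq _ _ _ _ _ (log_norm h s)
    (fun y => - (2^-1 * ln (f y * f y * hm y))))//; last first.
  have := open_near oWm Wmx; apply: filterS => y [Wy my].
  by rewrite /log_norm fE// metricZ ?expr2//; exact: lb_dom_sub my.
have dC : chart_differentiable A (fun _ : X => 2^-1 : R) x.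
  exact: differentiable_cst.
rewrite chart_partialN; last exact: differentiableM.
rewrite (chart_partialM _ Ax dC dL) [chart_partial A i (fun _ =>
  2^-1) x]partial_cst.
have H0 : 0 < f x * f x * hm x by rewrite mulr_gt0// -expr2 exprn_even_gt0.
rewrite (chart_partial_ln _ Ax dH H0) (chart_partial_ln _ Ax dh q0).
rewrite (chart_partialM _ Ax dff dh) (chart_partialM _ Ax df df).
have -> : chart_partial A i f x = - (f x * D m A x 0 i).
  by apply/eqP; rewrite -addr_eq0; apply/eqP.
by field; rewrite f0 gt_eqF.
Qed.

End FlatFrames.

Section Trivializations.
Context {R : realType} {n : nat} {X : manifold R n} (G : gerbe X).
Let U := gb_cover G.
Local Notation line := (@gb_line _ _ _ G).

Section OneTrivialization.
Variables (h : gerbe_metric G) (r : cochain2 X).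
Let V := c2_cover r.
Variables (rho : cov_idx V -> cov_idx U).
Variable t : forall a b x, line (rho a) (rho b) x.
Hypothesis tT : gerbe_trivialization t.
Hypothesis tr : trivialization_cocycle t.

Let oVV a b : open (V a `&` V b).
Proof. by apply: openI; exact: cov_open. Qed.

Let VU a b : V a `&` V b `<=` U (rho a) `&` U (rho b).
Proof. by have [rV _ _] := tT; move=> x [/rV ? /rV]. Qed.

Definition trivialization_log a b : X ->
  R := log_norm (h (rho a) (rho b)) (t a b).

Lemma smooth_trivialization_log a b :
  smooth_on (V a `&` V b) (trivialization_log a b).
Proof. by apply: smooth_log_norm => //; have [_ + _] := tT; apply. Qed.

Lemma trivialization_log_anti a b x : (V a `&` V b) x ->
  trivialization_log b a x = - trivialization_log a b x.
Proof.
move=> Vx; have Vx' : (V b `&` V a) x by case: Vx.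
have [_ tf tp] := tT.
have E := gm_pair h (VU Vx) (t a b x) (t b a x).
move: E; rewrite tp// expr1n => /(congr1 (@ln R)).
rewrite ln1 lnM ?posrE; try by apply: met_pos; [exact: VU|exact: (tf _ _).1].
by rewrite /trivialization_log /log_norm => /eqP; lra.
Qed.

(** The section s_ijk has norm 1, so the norm of t_ij (x) t_jk (x) t_ki is the
    inverse of |r_ijk|. *)
Lemma trivialization_log_sum a b d x : (V a `&` V b `&` V d) x ->
  ln `|r a b d x| = trivialization_log a b x + trivialization_log b d x +
                    trivialization_log d a x.
Proof.
move=> Vx; have [ab bd da _] := triple_sub Vx.
have [_ tf _] := tT; have := tr Vx; set T := gb_triv _ _ _ => E.
have Ux : (U (rho a) `&` U (rho b) `&` U (rho d)) x.
  by split; [exact: VU ab|exact: (VU bd).2].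
have T0 : T != 0.
  by apply: contraPneq E => ->; rewrite mulr0 => /eqP; rewrite oner_eq0.
have rE : r a b d x = T^-1 by rewrite -[RHS]mul1r E mulfK.
have := gm_triv h Ux (t a b x) (t b d x) (t d a x);
  rewrite -/T => /(congr1 (@ln R)).
have p a' b' : (V a' `&` V b') x ->
  0 < h (rho a') (rho b') x (t a' b' x) (t a' b' x).
  move=> Vab.
  by apply: met_pos; [exact: VU|exact: (tf _ _).1].
rewrite -real_normK ?num_real// lnXn ?normr_gt0// mulr2n.
rewrite !lnM ?posrE ?mulr_gt0 ?p//.
rewrite rE normfV lnV ?posrE ?normr_gt0//.
by rewrite /trivialization_log /log_norm => /eqP; lra.
Qed.

End OneTrivialization.

(** The forms of the adaptation, together with the logarithms of the norms of
    the flat frames, are de Rham data for the cocycle ln |c|. *)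
Lemma holonomy_de_rham (D : gerbe_connection G) (h : gerbe_metric G)
    (be : cov_idx U -> form1 X) (B : form2 X) (c : cochain2 X) :
  holonomy_form D h be B -> holonomy_cocycle D c ->
  cech_de_rham B (map_cochain (fun t => ln `|t|) c).
Proof.
move=> [[bf bth] _ Bd] [_ [rho [t [tT fl tr]]]]; have [rV tf _] := tT.
exists (fun a => be (rho a)), (fun a b => trivialization_log h t a b).
have oV a : open (c2_cover c a) by exact: cov_open.
split.
- move=> a; split; first by apply: is_form1_sub (bf _); exact: rV.
  by move=> A x /rV; exact: Bd.
- by move=> a b; exact: smooth_trivialization_log.
- by move=> a b x; exact: trivialization_log_anti.
- move=> a b; apply: (flat_frame_theta _ _ (tf a b) (fl a b) (bth _ _)).
    exact: openI.
  by move=> x [/rV ? /rV].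
- by move=> a b d x; exact: (trivialization_log_sum h tT tr).
Qed.

End Trivializations.

(** * Comparison of trivializations of a gerbe *)

Section Comparison.
Context {R : realType} {n : nat} {X : manifold R n} (G : gerbe X).
Let U := gb_cover G.
Local Notation line := (@gb_line _ _ _ G).

Section Trilinear.
Variables (i j k : cov_idx U).
Implicit Types (x : X).

Lemma gb_trivZ x (a : line i j x) (b : line j k x) (c : line k i x) s t u :
  (U i `&` U j `&` U k) x ->
  gb_triv (s *: a) (t *: b) (u *: c) = s * t * u * gb_triv a b c.
Proof.
move=> Ux; have [l1 l2 l3] := gb_triv_linear Ux.
by rewrite (scalar_funZ (l1 _ _)) (scalar_funZ (l2 _ _)) (scalar_funZ (l3 _ _))
  !mulrA.
Qed.

Lemma smooth_gb_triv (W : set X) (a : forall x, line i j x)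
    (b : forall x, line j k x) (c : forall x, line k i x) :
  open W -> W `<=` U i `&` U j `&` U k ->
  local_frame W a -> local_frame W b -> local_frame W c ->
  smooth_on W (fun x => gb_triv (a x) (b x) (c x)).
Proof.
move=> oW WU [_ af] [_ bf] [_ cf]; apply: smooth_local => x Wx.
have [ij jk ki _] := triple_sub (WU x Wx).
have [m1 m1x] := lb_dom_exists (line i j) ij.
have [m2 m2x] := lb_dom_exists (line j k) jk.
have [m3 m3x] := lb_dom_exists (line k i) ki.
have [f1 f1s f1E] := af m1; have [f2 f2s f2E] := bf m2;
  have [f3 f3s f3E] := cf m3.
pose N := W `&` (lb_dom m1 `&` lb_dom m2 `&` lb_dom m3).
have oN : open N by do 3?[apply: openI => //]; exact: lb_dom_open.
exists N => //.
apply: (@smooth_eq _ _ _ _ (fun y => f1 y * f2 y * f3 y *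
    gb_triv (lb_frame m1 y) (lb_frame m2 y) (lb_frame m3 y))) => //.
  by move=> y [Wy [[y1 y2] y3]]; rewrite f1E// f2E// f3E// gb_trivZ//;
    exact: WU.
apply: smoothM => //; last by apply: smooth_sub (gb_triv_smooth m1 m2 m3) =>
  y [].
apply: smoothM => //; last by apply: smooth_sub f3s => y [Wy [[]]].
by apply: smoothM => //; [apply: smooth_sub f1s|apply: smooth_sub f2s] =>
  y [Wy [[]]].
Qed.
End Trilinear.

Lemma dual_vector i j x (z : line j i x) : (U i `&` U j) x -> z != 0 ->
  exists2 w : line i j x, w != 0 & gb_pair w z = 1.
Proof.
move=> Ux z0; pose v := some_vector (line i j) x.
have v0 : v != 0 by exact: some_vector_neq0.
have p0 : gb_pair v z != 0 by exact: gb_pair_neq0.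
exists ((gb_pair v z)^-1 *: v); first by rewrite scaler_eq0 invr_eq0 negb_or p0.
by rewrite (scalar_funZ (gb_pair_linear Ux z)) mulVf.
Qed.

(** The prism over the triangles (i, j, k) and (i', j', k') is cut into the
    tetrahedra (i, j, k, k'), (i, j, j', k') and (i, i', j', k'); the identity
    is the product of the three instances of [gb_coclosed]. The vectors pi,
    pj, pk belong to the vertical edges and zji, zki, zkj to the diagonals,
    with reversed orientation. *)
Lemma prism i j k i' j' k' x :
  (U i `&` U j `&` U k) x -> (U i' `&` U j' `&` U k') x ->
  forall (ij : line i j x) (jk : line j k x) (ik : line i k x) (ki : line k i x)
    (ij' : line i' j' x) (jk' : line j' k' x) (ik' : line i' k' x)
    (ki' : line k' i' x)
    (pi : line i i' x) (pj : line j j' x) (pk : line k k' x)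
    (zji : line j' i x) (zki : line k' i x) (zkj : line k' j x),
  gb_pair ik ki = 1 -> gb_pair ik' ki' = 1 ->
  pi != 0 -> pj != 0 -> ij' != 0 -> jk' != 0 -> ik' != 0 ->
  zji != 0 -> zki != 0 -> zkj != 0 ->
  gb_triv ij jk ki * (gb_triv ik pk zki / gb_triv pi ik' zki) =
  gb_triv ij' jk' ki' * (gb_triv ij pj zji / gb_triv pi ij' zji) *
    (gb_triv jk pk zkj / gb_triv pj jk' zkj).
Proof.
move=> [[Ui Uj] Uk] [[Ui' Uj'] Uk'] ij jk ik ki ij' jk' ik' ki' pi pj pk zji
  zki zkj.
move=> d1 d2 pi0 pj0 ij0 jk0 ik0 zji0 zki0 zkj0.
have [zij zij0 dij] := @dual_vector i j' x zji (conj Ui Uj') zji0.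
have [zjk zjk0 djk] := @dual_vector j k' x zkj (conj Uj Uk') zkj0.
have E1 := @gb_coclosed _ _ _ G i j k k' x (conj (conj (conj Ui Uj) Uk) Uk')
  ij jk pk zki ik ki zjk zkj.
have E2 := @gb_coclosed _ _ _ G i j j' k' x (conj (conj (conj Ui Uj) Uj') Uk')
  ij pj jk' zki zij zji zjk zkj.
have E3 := @gb_coclosed _ _ _ G i i' j' k' x (conj (conj (conj Ui Ui') Uj') Uk')
  pi ij' jk' zki zij zji ik' ki'.
rewrite d1 djk !mulr1 in E1; rewrite dij djk !mulr1 in E2;
  rewrite dij d2 !mulr1 in E3.
have n1 : gb_triv pi ik' zki != 0 by apply: gb_triv_neq0.
have n2 : gb_triv pi ij' zji != 0 by apply: gb_triv_neq0.
have n3 : gb_triv pj jk' zkj != 0 by apply: gb_triv_neq0.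
move: E1 E2 E3 n1 n2 n3.
move: (gb_triv ij jk ki) (gb_triv ik pk zki) (gb_triv pi ik' zki)
  (gb_triv ij' jk' ki') (gb_triv ij pj zji) (gb_triv pi ij' zji)
  (gb_triv jk pk zkj) (gb_triv pj jk' zkj) (gb_triv ij zjk zki)
  (gb_triv zij jk' zki) => A A3 C2 C B4 C4 A1 B1 A2 B3 E1 E2 E3 n1 n2 n3.
apply: (mulIf n1); apply: (mulIf n3); apply: (mulIf n2).
transitivity (A3 * A * B1 * C4); first by field; rewrite n1.
rewrite -E1.
transitivity (C * C2 * B4 * A1); last by field; rewrite n2 n3.
rewrite E3.
transitivity (A1 * C4 * (B1 * A2)); first by ring.
by rewrite E2; ring.
Qed.

(** The two refinement maps si and si' into the cover of the gerbe give two
    vertices for every index. On a finer cover the bundles that join si a and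
    si' a have frames p_a; these, the two trivializations and an arbitrary
    diagonal z fill the side of a prism, and u_ab is the quotient of the two
    triangles of that side. It does not depend on z, so it is smooth; its
    coboundary is computed in [prism]. *)
Lemma trivialization_comparison (r r' : cochain2 X)
    (rho : cov_idx (c2_cover r) -> cov_idx U)
    (rho' : cov_idx (c2_cover r') -> cov_idx U)
    (t : forall a b x, line (rho a) (rho b) x)
    (t' : forall a b x, line (rho' a) (rho' b) x)
    (W : open_cover X) (pi : cov_idx W -> cov_idx (c2_cover r))
    (pi' : cov_idx W -> cov_idx (c2_cover r')) :
  gerbe_trivialization t -> trivialization_cocycle t ->
  gerbe_trivialization t' -> trivialization_cocycle t' ->
  refines pi -> refines pi' ->
  exists (W' : open_cover X) (kap : cov_idx W' -> cov_idx W)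
      (u : cov_idx W' -> cov_idx W' -> X -> R),
    [/\ refines kap,
      forall a b, smooth_on (W' a `&` W' b) (u a b) /\
        forall x, (W' a `&` W' b) x -> u a b x != 0 &
      forall a b d x, (W' a `&` W' b `&` W' d) x ->
        r' (pi' (kap a)) (pi' (kap b)) (pi' (kap d)) x * u a d x =
        r (pi (kap a)) (pi (kap b)) (pi (kap d)) x * u a b x * u b d x].
Proof.
move=> [rV tf tp] tr [rV' tf' tp'] tr' piW piW'.
pose si a := rho (pi a); pose si' a := rho' (pi' a).
have siU a : W a `<=` U (si a) by move=> x /piW/rV.
have siU' a : W a `<=` U (si' a) by move=> x /piW'/rV'.
have [||W' [kap [kr frames]]] := @small_refinement _ _ X W
    (fun a V => exists m : lb_idx (line (si a) (si' a)), V `<=` lb_dom m).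
- by move=> a V V' VV [m Vm]; exists m => x /VV/Vm.
- move=> a x Wx.
  have [m mx] := lb_dom_exists (line (si a) (si' a)) (conj (siU _ _ Wx) (siU' _
    _ Wx)).
  by exists (lb_dom m); [exact: open_near (lb_dom_open m) mx|exists m].
pose m a := sval (cid (frames a)).
have mW a : W' a `<=` lb_dom (m a) by exact: (svalP (cid (frames a))).
pose p a x := lb_frame (m a) x.
pose T a b x := t (pi (kap a)) (pi (kap b)) x.
pose T' a b x := t' (pi' (kap a)) (pi' (kap b)) x.
pose num a b x (z : line (si' (kap b)) (si (kap a)) x) := gb_triv (T a b x) (p
  b x) z.
pose den a b x (z : line (si' (kap b)) (si (kap a)) x) := gb_triv (p a x) (T' a
  b x) z.
pose zz a b x := some_vector (line (si' (kap b)) (si (kap a))) x.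
have oW a : open (W' a) by exact: cov_open.
have inU a x : W' a x -> U (si (kap a)) x by move=> /kr/siU.
have inU' a x : W' a x -> U (si' (kap a)) x by move=> /kr/siU'.
have Tf a b : local_frame (W' a `&` W' b) (T a b).
  by apply: local_frame_sub (tf _ _) => x [/kr/piW ? /kr/piW].
have Tf' a b : local_frame (W' a `&` W' b) (T' a b).
  by apply: local_frame_sub (tf' _ _) => x [/kr/piW' ? /kr/piW'].
have pf a : local_frame (W' a) (p a) by exact: local_frame_lb_frame.
have den0 a b x z : (W' a `&` W' b) x -> z != 0 -> @den a b x z != 0.
  move=> [Wa Wb] z0; apply: gb_triv_neq0 => //.
  - by split; [split|]; [exact: inU|exact: inU'|exact: inU'].
  - exact: (pf a).1.
  - exact: (Tf' a b).1.
have num0 a b x z : (W' a `&` W' b) x -> z != 0 -> @num a b x z != 0.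
  move=> [Wa Wb] z0; apply: gb_triv_neq0 => //.
  - by split; [split|]; [exact: inU|exact: inU|exact: inU'].
  - exact: (Tf a b).1.
  - exact: (pf b).1.
have zz0 a b x : (W' a `&` W' b) x -> zz a b x != 0.
  by move=> [Wa Wb]; apply: some_vector_neq0; split; [exact: inU'|exact: inU].
exists W', kap, (fun a b x => @num a b x (zz a b x) / @den a b x (zz a b x)).
split=> // [a b|a b d x Wx].
  split; last first.
    move=> x Wx; rewrite mulf_neq0 ?invr_eq0//; last exact/den0/zz0.
    exact/num0/zz0.
  apply: smooth_local => x Wx; have [Wa Wb] := Wx.
  have [e ex] := lb_dom_exists (line (si' (kap b)) (si (kap a)))
    (conj (inU' _ _ Wb) (inU _ _ Wa)).
  pose N := W' a `&` W' b `&` lb_dom e.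
  have oN : open N by do 2?[apply: openI => //]; exact: lb_dom_open.
  have ef : local_frame N (lb_frame e) by apply: local_frame_lb_frame => y [].
  exists N => //.
  apply: (@smooth_eq _ _ _ _ (fun y => @num a b y (lb_frame e y) *
      (@den a b y (lb_frame e y))^-1)) => //.
    move=> y [Wy ey]; have [Wya Wyb] := Wy.
    have e0 := frame_neq0 ey.
    have [s sE] := line_span (zz a b y) (conj (inU' _ _ Wyb) (inU _ _ Wya)) e0.
    have s0 : s != 0.
      by have := zz0 a b y Wy; rewrite sE; apply: contra_neq => ->;
        rewrite scale0r.
    have nE : @num a b y (zz a b y) = s * @num a b y (lb_frame e y).
      rewrite /num sE -[T a b y]scale1r -[p b y]scale1r gb_trivZ ?scale1r
        ?mul1r//.
      by split; [split|]; [exact: inU|exact: inU|exact: inU'].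
    have dE : @den a b y (zz a b y) = s * @den a b y (lb_frame e y).
      rewrite /den sE -[p a y]scale1r -[T' a b y]scale1r gb_trivZ ?scale1r
        ?mul1r//.
      by split; [split|]; [exact: inU|exact: inU'|exact: inU'].
    have d0 : @den a b y (lb_frame e y) != 0 by exact: den0.
    by rewrite nE dE; field; rewrite s0 d0.
  apply: smoothM => //; last apply: smoothV => //.
  - apply: smooth_gb_triv => //.
    + by move=> y [[Wya Wyb] _]; split; [split|];
      [exact: inU|exact: inU|exact: inU'].
    + by apply: local_frame_sub (Tf a b) => y [].
    + by apply: local_frame_sub (pf b) => y [[]].
  - by move=> y [Wy ey]; apply: den0 => //; exact: frame_neq0.
  - apply: smooth_gb_triv => //.
    + by move=> y [[Wya Wyb] _]; split; [split|];
      [exact: inU|exact: inU'|exact: inU'].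
    + by apply: local_frame_sub (pf a) => y [[]].
    + by apply: local_frame_sub (Tf' a b) => y [].
have [[Wa Wb] Wd] := Wx; have [ab bd da ad] := triple_sub Wx.
have Vx : (c2_cover r (pi (kap a)) `&` c2_cover r (pi (kap b)) `&` c2_cover r
  (pi (kap d))) x.
  by split; [split|]; exact/piW/kr.
have Vx' : (c2_cover r' (pi' (kap a)) `&` c2_cover r' (pi' (kap b)) `&`
  c2_cover r' (pi' (kap d))) x.
  by split; [split|]; exact/piW'/kr.
have E := tr _ _ _ _ Vx; have E' := tr' _ _ _ _ Vx'.
have [[Va Vb] Vd] := Vx; have [[Va' Vb'] Vd'] := Vx'.
have P := @prism _ _ _ _ _ _ x
  (conj (conj (inU _ _ Wa) (inU _ _ Wb)) (inU _ _ Wd))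
  (conj (conj (inU' _ _ Wa) (inU' _ _ Wb)) (inU' _ _ Wd))
  (T a b x) (T b d x) (T a d x) (T d a x)
  (T' a b x) (T' b d x) (T' a d x) (T' d a x)
  (p a x) (p b x) (p d x) (zz a b x) (zz a d x) (zz b d x)
  (tp _ _ _ (conj Va Vd)) (tp' _ _ _ (conj Va' Vd'))
  ((pf a).1 x Wa) ((pf b).1 x Wb) ((Tf' a b).1 x ab) ((Tf' b d).1 x bd)
  ((Tf' a d).1 x ad) (zz0 a b x ab) (zz0 a d x ad) (zz0 b d x bd).
rewrite -/(num a d x _) -/(num a b x _) -/(num b d x _) in P.
rewrite -/(den a d x _) -/(den a b x _) -/(den b d x _) in P.
move: P E E'; rewrite /T /T' => P E E'.
move: P E E'.
move: (gb_triv (t _ _ x) (t _ _ x) (t _ _ x)) (gb_triv (t' _ _ x) (t' _ _ x)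
  (t' _ _ x)).
move: (num a d x _ / _) (num a b x _ / _) (num b d x _ / _).
move: (r _ _ _ _) (r' _ _ _ _) => c c' uad uab ubd S S' P E E'.
rewrite -[RHS]mul1r E' -[LHS]mul1r E.
transitivity (c * c' * (S * uad)); first by ring.
by rewrite P; ring.
Qed.

End Comparison.

(** * The sign of the holonomy *)

Section SignClass.
Context {R : realType} {n : nat} {X : manifold R n}.

Lemma locally_constant_sg (W : set X) (u : X -> R) : open W -> smooth_on W u ->
  (forall x, W x -> u x != 0) -> locally_constant W (fun x => Num.sg (u x)).
Proof.
move=> oW us u0 x Wx; have uc : u @ x --> u x := smooth_continuous us Wx oW.
have := u0 x Wx; rewrite neq_lt => /orP[ux|ux].
  have : \forall y \near x, u y < 0.
    by apply: (uc [set s : R | s < 0]); apply: open_nbhs_nbhs; split;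
      [exact: open_lt|exact: ux].
  by apply: filterS => y uy; rewrite !ltr0_sg.
have : \forall y \near x, 0 < u y.
  by apply: (uc [set s : R | 0 < s]); apply: open_nbhs_nbhs; split;
    [exact: open_gt|exact: ux].
by apply: filterS => y uy; rewrite !gtr0_sg.
Qed.

Lemma sg_eq1 (s : R) : s != 0 -> Num.sg s = 1 \/ Num.sg s = -1.
Proof. by rewrite neq_lt => /orP[]/= s0; [right; exact: ltr0_sg|left;
  exact: gtr0_sg]. Qed.

Lemma coef_Z2_sg (W : set X) (u : X -> R) : open W -> smooth_on W u ->
  (forall x, W x -> u x != 0) -> coef_sec (coef_Z2 X) W (fun x => Num.sg (u x)).
Proof.
move=> oW us u0; split; first exact: locally_constant_sg.
by move=> x /u0; exact: sg_eq1.
Qed.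

(** The cocycle |c| is the coboundary of the smooth positive functions exp
    f_ij, where f_ij = - (1/2) ln h(t_ij, t_ij), so c and sgn c define the
    same class with coefficients in the smooth nowhere vanishing functions.
    Conversely, if a Z_2-valued cocycle z defines the class of the gerbe, then
    c and z differ by the coboundary of smooth functions, by
    [trivialization_comparison]. The signs of these functions are locally
    constant, and their coboundary is the difference of sgn c and z. *)
Lemma sgn_class_gerbe_class (G : gerbe X) (D : gerbe_connection G)
    (h : gerbe_metric G) (c : cochain2 X) :
  holonomy_cocycle D c -> sgn_class c = gerbe_class G.
Proof.
move=> [[cs cc] [rho [t [tT _ tr]]]]; apply/seteqP; split => z [zC].
  move=> [W [pi [piz [q [piV pizV qs qE]]]]]; split=> //.
  exists c.
    split; last by exists rho, t.
    split=> // i j k; have [clc c0] := cs i j k; split=> //.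
    apply: smooth_locally_constant clc.
    by do 2?[apply: openI]; exact: cov_open.
  pose f := trivialization_log h t.
  have oWW a b : open (W a `&` W b) by apply: openI; exact: cov_open.
  have q0 a b x : (W a `&` W b) x -> q a b x != 0.
    by move=> /(qs a b).2[]->; rewrite ?oppr_eq0 oner_eq0.
  exists W, piz, pi, (fun a b x => (q a b x)^-1 * expR (f (pi a) (pi b) x)).
  split=> //.
  - move=> a b; split; last first.
      by move=> x Wx; rewrite mulf_neq0 ?invr_eq0 ?q0// gt_eqF// expR_gt0.
    apply: smoothM => //.
      by apply: smoothV => //; [exact: q0|exact: smooth_locally_constant (qs a
        b).1].
    apply: smooth_expR => //.
    by apply: smooth_sub (smooth_trivialization_log h tT _ _) =>
      x [/piV ? /piV].
  - move=> a b d x Wx; have [ab bd da ad] := triple_sub Wx.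
    have [[/piV Va /piV Vb] /piV Vd] := Wx.
    have zE := qE a b d x Wx; rewrite /= in zE.
    have lnc := trivialization_log_sum h tT tr (conj (conj Va Vb) Vd).
    rewrite (trivialization_log_anti h tT (conj Va Vd)) -/f in lnc.
    have c0 := (cs (pi a) (pi b) (pi d)).2 x (conj (conj Va Vb) Vd).
    rewrite /= [c _ _ _ _]numEsg -[`|c _ _ _ _|]lnK ?posrE ?normr_gt0//.
    rewrite lnc !expRD expRN.
    have ead : expR (f (pi a) (pi d) x) != 0 by rewrite gt_eqF// expR_gt0.
    have qab := q0 _ _ _ ab; have qbd := q0 _ _ _ bd; have qad := q0 _ _ _ ad.
    rewrite -[z _ _ _ _](mulfK qad) zE.
    by field; rewrite qab qbd qad ead.
move=> [r [rC [rho' [t' [tT' tr']]]] [W1 [piz [pir [q [pizV pirV qs qE]]]]]].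
split=> //.
pose W := cover_meet W1 (c2_cover c).
have piW : @refines _ _ X W (c2_cover c) (fun a => a.2) by move=> a x [].
have piW' : @refines _ _ X W (c2_cover r) (fun a =>
  pir a.1) by move=> a x [/pirV].
have [W' [kap [u [kr us uE]]]] := trivialization_comparison tT tr tT' tr' piW
  piW'.
have kW1 a : W' a `<=` W1 (kap a).1 by move=> x /kr[].
exists W', (fun a => (kap a).2), (fun a => piz (kap a).1).
exists (fun a b x => Num.sg (u a b x / q (kap a).1 (kap b).1 x)).
have oWW a b : open (W' a `&` W' b) by apply: openI; exact: cov_open.
have q0 a b x : (W' a `&` W' b) x -> q (kap a).1 (kap b).1 x != 0.
  by move=> [/kW1 Wa /kW1 Wb]; exact: (qs _ _).2.
split.
- by move=> a x /kr[].
- by move=> a x /kW1/pizV.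
- move=> a b; apply: coef_Z2_sg => //.
    apply: smoothM => //; first exact: (us a b).1.
    apply: smoothV => //; first exact: q0.
    by apply: smooth_sub (qs _ _).1 => x [/kW1 ? /kW1].
  by move=> x Wx; rewrite mulf_neq0 ?invr_eq0 ?q0//; exact: (us a b).2.
- move=> a b d x Wx; have [ab bd da ad] := triple_sub Wx.
  have [[Wa Wb] Wd] := Wx.
  have W1x : (W1 (kap a).1 `&` W1 (kap b).1 `&` W1 (kap d).1) x.
    by split; [split|]; exact: kW1.
  have := qE _ _ _ _ W1x; have := uE a b d x Wx => /=.
  have Vz : (c2_cover z (piz (kap a).1) `&` c2_cover z (piz (kap b).1) `&`
      c2_cover z (piz (kap d).1)) x.
    by have [[? ?] ?] := W1x; split; [split|]; exact: pizV.
  have zS : z (piz (kap a).1) (piz (kap b).1) (piz (kap d).1) x =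
      Num.sg (z (piz (kap a).1) (piz (kap b).1) (piz (kap d).1) x).
    by have [->|->] := (zC.1 _ _ _).2 x Vz; rewrite ?sgrN sgr1.
  have qab := q0 _ _ _ ab; have qbd := q0 _ _ _ bd; have qad := q0 _ _ _ ad.
  move=> uE' zE; rewrite zS -!sgrM; congr Num.sg.
  have -> : z (piz (kap a).1) (piz (kap b).1) (piz (kap d).1) x =
      r (pir (kap a).1) (pir (kap b).1) (pir (kap d).1) x *
      q (kap a).1 (kap d).1 x / (q (kap a).1 (kap b).1 x * q (kap b).1 (kap
        d).1 x).
    by rewrite zE; field; rewrite qab qbd.
  transitivity (r (pir (kap a).1) (pir (kap b).1) (pir (kap d).1) x * u a d x /
      (q (kap a).1 (kap b).1 x * q (kap b).1 (kap d).1 x)).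
    by field; rewrite qab qbd qad.
  by rewrite uE'; field; rewrite qab qbd.
Qed.

End SignClass.

Theorem theorem3p3 (R : realType) (n : nat) (X : manifold R n) (G : gerbe X)
    (D : gerbe_connection G) (flatD : gerbe_flat D) :
  (forall (h h' : gerbe_metric G)
      (beta beta' : cov_idx (gb_cover G) -> form1 X) (B B' : form2 X),
    holonomy_form D h beta B -> holonomy_form D h' beta' B' ->
    de_rham_cohomologous B B') /\
  (forall (h : gerbe_metric G) (beta : cov_idx (gb_cover G) -> form1 X)
      (B : form2 X) (c : cochain2 X),
    holonomy_form D h beta B -> holonomy_cocycle D c ->
    de_rham_class B = lnabs_class c /\
    (sgn_class c, lnabs_class c) = (gerbe_class G, de_rham_class B)).
Proof.
split=> [h h' be be' B B' HB HB'|h be B c HB Hc].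
  exact: holonomy_form_independent HB HB'.
have E : de_rham_class B = lnabs_class c.
  have Bc := holonomy_de_rham HB Hc.
  apply/seteqP; split => y [yC].
    by move=> [y' [_ By' y'y]]; split=> //;
      exact: cech_de_rham_cohomologous Bc By' y'y.
  move=> cy; split=> //; exists (map_cochain (fun t => ln `|t|) c).
  by split=> //; apply: is_cocycle_lnabs; case: Hc.
by split=> //; rewrite E (sgn_class_gerbe_class h Hc).
Qed.
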